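(* Let $\Omega=(\mathcal{C},\mathcal{D};\Gamma,\Delta)$ be a cross-connection of consistent categories. Let $\mathcal{I}(\Omega)$ be the category whose object set is $E_\Omega=\{(c,d)\in v\mathcal{C}\times v\mathcal{D}: c\in M\Gamma(d)\}$ (the regular biordered set of idempotents of the cross-connection semigroup $\mathbb{S}\Omega$, with $(c,d)$ identified with $(\gamma(c,d),\delta(c,d))$), and whose morphisms from $(c,d)$ to $(c',d')$ are the bimorphisms $u\colon c\to c'$ of $\mathcal{C}$, composed as in $\mathcal{C}$. For morphisms $u_1\colon(c_1,d_1)\to(c_1',d_1')$ and $u_2\colon(c_2,d_2)\to(c_2',d_2')$, with connecting isomorphisms $\upsilon_1$ and $\upsilon_2$ respectively, put $$u_1\leq_\Omega u_2\iff (c_1,d_1)\subseteq(c_2,d_2),\quad u_1=(j_{c_1}^{c_2}u_2)^\circ\ \text{ and }\ (c_1',d_1')=(c_1,d_1)\upsilon_2 .$$ For a morphism $u\colon(c,d)\to(c',d')$ with connecting isomorphism $\upsilon$: the restriction of $u$ to $(c_1,d_1)\subseteq(c,d)$ is $(j_{c_1}^cu)^\circ$, and the corestriction of $u$ to $(c_1',d_1')\subseteq(c',d')$ is $(j_{c_1}^cu)^\circ$, where $(c_1,d_1)=(c_1',d_1')\upsilon^{-1}$. For $(c,d)\mathrel{\mathscr{R}}(c',d')$ or $(c,d)\mathrel{\mathscr{L}}(c',d')$ let the distinguished morphism from $(c,d)$ to $(c',d')$ be the isomorphism $\gamma(c',d')(c)$. Then $(\mathcal{I}(\Omega),\leq_\Omega)$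 is an inductive cancellative category.
   Context: Functions, morphisms and natural transformations are composed from left to right. **Categories with subobjects.** A pair $(\mathcal{C},\mathcal{P})$, with $\mathcal{C}$ a small category and $\mathcal{P}$ a subcategory, such that: $\mathcal{P}$ is a strict preorder (at most one morphism between any two objects; identities are the only isomorphisms) with $v\mathcal{P}=v\mathcal{C}$ ($v$ denotes the object set); every $f\in\mathcal{P}$ is a monomorphism in $\mathcal{C}$; if $f,g\in\mathcal{P}$ and $f=hg$ with $h\in\mathcal{C}$, then $h\in\mathcal{P}$. Morphisms of $\mathcal{P}$ are inclusions; write $c'\subseteq c$ ($c'$ is a subobject of $c$) and $j_{c'}^{c}$ for the inclusion $c'\to c$. An inclusion $j_{c'}^c$ splits if there is $q\colon c\to c'$ with $j_{c'}^cq=1_{c'}$; such $q$ is a retraction. A bimorphism is a morphism that is both left and right cancellable. A consistent (resp. normal) factorisation of $f$ is $f=quj$ with $q$ a retraction, $u$ a bimorphism (resp. isomorphism), $j$ an inclusion; then $f^\circ=qu$ (which is unique) is the epimorphic component of $f$, and its codomain is $\mathrm{im} f$. For $c\in v\mathcal{C}$, the ideal $(c)$ is the full subcategory of $\mathcal{C}$ on the subobjects of $c$; $\sigma(c)$ is the preorder of subobjects of $c$ with inclusions as morphisms; $cor\,\mathcal{C}$ is the subcategory of $\mathcal{C}$ generated by inclusions and retractions, and $\langle c\rangle$ is the full subcategory of $cor\,\mathcal{C}$ generated by the inclusions and retractions among the subobjects of $c$. A bimorphism $u\colon c\to d$ is consistent if the functor $T^u\colon\sigma(c)\to\sigma(d)$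 defined by $T^u(c')=\mathrm{im}(j_{c'}^cu)$ and $T^u(j_{c'}^{c''})=j_{T^u(c')}^{T^u(c'')}$ for each $c'\subseteq c''\subseteq c$ can be extended uniquely to an isomorphism $T\colon\langle c\rangle\to\langle d\rangle$ such that the map given by $c'\mapsto T(c')$ is a natural isomorphism between the functors $J(\langle c\rangle,\mathcal{C})$ and $T\colon\langle c\rangle\to\mathcal{C}$, where $J(\langle c\rangle,\mathcal{C})$ is the inclusion functor of $\langle c\rangle$ in $\mathcal{C}$. A consistent cone $\gamma$ with apex $c_\gamma$ is a map $\gamma\colon v\mathcal{C}\to\mathcal{C}$, $\gamma(a)\in\mathcal{C}(a,c_\gamma)$, with $j_a^b\gamma(b)=\gamma(a)$ whenever $a\subseteq b$ and with at least one $\gamma(c)$ a bimorphism. **Consistent category.** A category $\mathcal{C}$ with subobjects such that: every inclusion splits; every morphism has a consistent factorisation; every bimorphism is consistent; every morphism of the form $jq$ with $j$ an inclusion and $q$ a retraction has a normal factorisation; for each $c\in v\mathcal{C}$ there is a consistent cone $\epsilon$ with $\epsilon(c)=1_c$. **Cones and dual.** For a consistent cone $\gamma$ and an epimorphism $f\colon c_\gamma\to d$, $\gamma\ast f$ is the cone $c\mapsto\gamma(c)f$ with apex $d$. Consistent cones form a semigroup under $\gamma^{(1)}\cdot\gamma^{(2)}=\gamma^{(1)}\ast(\gamma^{(2)}(c_{\gamma^{(1)}}))^\circ$; $\epsilon$ is an idempotent cone iff $\epsilon(c_\epsilon)=1_{c_\epsilon}$. For an idempotent cone $\epsilon$, $H(\epsilon;-)\colon\mathcal{C}\to\mathbf{Set}$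 is given by $H(\epsilon;c)=\{\epsilon\ast f^\circ: f\in\mathcal{C}(c_\epsilon,c)\}$, $H(\epsilon;g)\colon\epsilon\ast f^\circ\mapsto\epsilon\ast(fg)^\circ$; $\eta_\epsilon\colon H(\epsilon;-)\to\mathcal{C}(c_\epsilon,-)$, $\epsilon\ast f^\circ\mapsto f$, is a natural isomorphism. The consistent dual $\mathcal{C}^*$ is the full subcategory of $[\mathcal{C},\mathbf{Set}]$ on the functors $H(\epsilon;-)$, $\epsilon$ an idempotent cone; its inclusions are the inclusions of subfunctors. $MH(\epsilon;-)=\{c\in v\mathcal{C}:\epsilon(c)\text{ is an isomorphism}\}$. **Cross-connection.** A functor $F\colon\mathcal{C}\to\mathcal{D}$ between consistent categories is a local isomorphism if it is inclusion preserving, fully faithful, and for each $c\in v\mathcal{C}$ restricts to an isomorphism of the ideal $(c)$ onto $(F(c))$. A cross-connection $\Omega=(\mathcal{C},\mathcal{D};\Gamma,\Delta)$ consists of local isomorphisms $\Gamma\colon\mathcal{D}\to\mathcal{C}^*$, $\Delta\colon\mathcal{C}\to\mathcal{D}^*$ such that $c\in M\Gamma(d)\iff d\in M\Delta(c)$ for all $c\in v\mathcal{C}$, $d\in v\mathcal{D}$. For $(c,d)\in E_\Omega$, $\gamma(c,d)$ is the unique idempotent cone in $\mathcal{C}$ with apex $c$ and $H(\gamma(c,d);-)=\Gamma(d)$, and $\delta(c,d)$ is the unique idempotent cone in $\mathcal{D}$ with apex $d$ and $H(\delta(c,d);-)=\Delta(c)$. For $f\in\mathcal{C}(c',c)$,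 $d\in M\Delta(c')$, $d'\in M\Delta(c)$, the transpose $f^\ddagger\in\mathcal{D}(d',d)$ is the unique morphism with $\mathcal{D}(f^\ddagger,-)=\eta_{\delta(c',d)}^{-1}\,\Delta(f)\,\eta_{\delta(c,d')}$. **Cross-connection semigroup.** Put $\Gamma(c,d)=\Gamma(d)(c)=\{\gamma(c',d)\ast f^\circ: c'\in M\Gamma(d), f\in\mathcal{C}(c',c)\}$, $\Delta(c,d)=\Delta(c)(d)=\{\delta(c,d')\ast g^\circ: d'\in M\Delta(c), g\in\mathcal{D}(d',d)\}$, and let $\chi(c,d)\colon\Gamma(c,d)\to\Delta(c,d)$ be the bijection $\gamma(c',d)\ast f^\circ\mapsto\delta(c,d')\ast(f^\ddagger)^\circ$, $f^\ddagger\in\mathcal{D}(d',d)$. A pair $(\gamma,\delta)$ is linked if for some $(c,d)\in v\mathcal{C}\times v\mathcal{D}$, $\gamma\in\Gamma(c,d)$ and $\delta=\chi(c,d)(\gamma)$. $\mathbb{S}\Omega$ is the semigroup of linked pairs with $(\gamma,\delta)\circ(\gamma',\delta')=(\gamma\cdot\gamma',\delta'\cdot\delta)$. Its idempotents are the pairs $(\gamma(c,d),\delta(c,d))$, $(c,d)\in E_\Omega$; the biorder relations are $(c,d)\mathrel{\omega^l}(c',d')\iff c\subseteq c'$, $(c,d)\mathrel{\omega^r}(c',d')\iff d\subseteq d'$; $(c,d)\subseteq(c',d')$ means $c\subseteq c'$ and $d\subseteq d'$. The connecting isomorphism of a morphism $u\colon(c,d)\to(c',d')$ is that of the element $x_u=(\gamma(c,d)\ast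 u,\ \delta(c',d')\ast u^\ddagger)\in\mathbb{S}\Omega$, $u^\ddagger\in\mathcal{D}(d',d)$: the isomorphism $\upsilon\colon\langle(c,d)\rangle\to\langle(c',d')\rangle$ with $y\,x_u=x_u\,(y\upsilon)$ for all $y\in\langle(c,d)\rangle$, where for an idempotent $e$, $\langle e\rangle$ is the subsemigroup generated by $\omega(e)=\{g: g \text{ idempotent}, ge=eg=g\}$; it restricts to a bijection $\omega((c,d))\to\omega((c',d'))$. **Ordered cancellative category.** A small category $\mathcal{I}$ with a partial order $\leq$ on it ($\mathbf d,\mathbf r$ = domain, codomain) such that: (OCC1) every morphism is a bimorphism; (OCC2) if $u\leq x$, $v\leq y$, $\mathbf r(u)=\mathbf d(v)$, $\mathbf r(x)=\mathbf d(y)$, then $uv\leq xy$; (OCC3) if $x\leq y$ then $1_{\mathbf d(x)}\leq1_{\mathbf d(y)}$ and $1_{\mathbf r(x)}\leq1_{\mathbf r(y)}$; (OCC4) if $1_e\leq1_{\mathbf d(x)}$ there is a unique $e{\downharpoonleft}x\leq x$ (restriction) with $\mathbf d(e{\downharpoonleft}x)=e$; (OCC5) if $1_f\leq1_{\mathbf r(x)}$ there is a unique $x{\downharpoonright}f\leq x$ (corestriction) with $\mathbf r(x{\downharpoonright}f)=f$. **Inductive cancellative category.** In a regular biordered set $E$ (the idempotents of a semigroup in which they generate a regular subsemigroup), $e\mathrel{\omega^l}f\iff ef=e$, $e\mathrel{\omega^r}f\iff fe=e$, $\omega=\omega^l\cap\omega^r$, $\mathscr{L}=\omega^l\cap(\omega^l)^{-1}$,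 $\mathscr{R}=\omega^r\cap(\omega^r)^{-1}$; a singular $E$-square is a square $\bigl[\begin{smallmatrix} e & f \\ g & h \end{smallmatrix}\bigr]$ of the form $\bigl[\begin{smallmatrix} g & h \\ kg & kh \end{smallmatrix}\bigr]$ with $g,h\mathrel{\omega^l}k$, $g\mathrel{\mathscr{R}}h$, or of the form $\bigl[\begin{smallmatrix} g & gk \\ h & hk \end{smallmatrix}\bigr]$ with $g,h\mathrel{\omega^r}k$, $g\mathrel{\mathscr{L}}h$. An ordered cancellative category $(\mathcal{I},\leq)$ with $v\mathcal{I}=E$ a regular biordered set such that $\omega$ coincides with $\leq$ on $E$, equipped with a distinguished morphism $[e,f]\colon e\to f$ whenever $e\mathrel{\mathscr{R}}f$ or $e\mathrel{\mathscr{L}}f$, such that (i) $[e,e]=1_e$; (ii) $[e,f][f,g]=[e,g]$ if $e\mathrel{\mathscr{R}}f\mathrel{\mathscr{R}}g$ or $e\mathrel{\mathscr{L}}f\mathrel{\mathscr{L}}g$; (iii) if $[g,h]$ exists and $e\mathrel{\omega}g$ then $[e,f]$ exists with $f=heh$ and $[e,f]\leq[g,h]$; is an inductive cancellative category if the following and their duals hold: (ICC1) for $x\in\mathcal{I}$ and $e_1,e_2\leq\mathbf d(x)$, $f_i=\mathbf r(e_i{\downharpoonleft}x)$: if $e_1\mathrel{\omega^r}e_2$ then $f_1\mathrel{\omega^r}f_2$ and $[e_1,e_1e_2](e_1e_2{\downharpoonleft}x)=(e_1{\downharpoonleft}x)[f_1,f_1f_2]$; (ICC2) if $\bigl[\begin{smallmatrix}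 e & f \\ g & h \end{smallmatrix}\bigr]$ is a singular $E$-square then $[e,f][f,h]=[e,g][g,h]$.
   Formalization: That each χ(c,d) is a well-defined bijection, and that E_Ω is the regular biordered set of idempotents of the semigroup SΩ, are assumed as hypotheses, since they do not follow from the stated definition of a cross-connection of consistent categories. *)

(* Defs.v *)
From Stdlib Require Import ClassicalEpsilon FunctionalExtensionality
  PropExtensionality ProofIrrelevance Relations.

Set Implicit Arguments.
Unset Strict Implicit.
Unset Printing Implicit Defensive.

(* Morphisms, functors and natural transformations are composed from left to
   right: [f ;; g] is "f, then g". *)

Record category := Category {
  ob :> Type;
  hom : ob -> ob -> Type;
  idm : forall a, hom a a;
  comp : forall a b c, hom a b -> hom b c -> hom a c;
  comp_idl : forall a b (f : hom a b), comp (idm a) f = f;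
  comp_idr : forall a b (f : hom a b), comp f (idm b) = f;
  comp_assoc : forall a b c d (f : hom a b) (g : hom b c) (h : hom c d),
    comp f (comp g h) = comp (comp f g) h }.

Arguments hom {_} _ _.
Arguments idm {_} _.
Arguments comp {_ _ _ _} _ _.

Notation "f ;; g" := (comp f g) (at level 40, left associativity).

Section Morphisms.
Context {C : category}.

Definition mono {a b : C} (f : hom a b) : Prop :=
  forall z (g h : hom z a), g ;; f = h ;; f -> g = h.

Definition epi {a b : C} (f : hom a b) : Prop :=
  forall z (g h : hom b z), f ;; g = f ;; h -> g = h.

Definition bimorphism {a b : C} (f : hom a b) : Prop := mono f /\ epi f.

Definition iso {a b : C} (f : hom a b) : Prop :=
  exists g : hom b a, f ;; g = idm a /\ g ;; f = idm b.

Lemma bimorphism_id (a : C) : bimorphism (idm a).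
Proof.
split; intros z g h.
- now rewrite !comp_idr.
- now rewrite !comp_idl.
Qed.

Lemma bimorphism_comp (a b c : C) (f : hom a b) (g : hom b c) :
  bimorphism f -> bimorphism g -> bimorphism (f ;; g).
Proof.
intros [mf ef] [mg eg]; split; intros z h k E.
- now apply mf, mg; rewrite <- !comp_assoc.
- now apply eg, ef; rewrite !comp_assoc.
Qed.

End Morphisms.

Record functor (C D : category) := Functor {
  fob :> C -> D;
  fmap : forall a b : C, hom a b -> hom (fob a) (fob b);
  fmap_id : forall a, fmap (idm a) = idm (fob a);
  fmap_comp : forall a b c (f : hom a b) (g : hom b c),
    fmap (f ;; g) = fmap f ;; fmap g }.

Arguments fmap {C D} _ {a b} _.

Definition fully_faithful {C D : category} (F : functor C D) : Prop :=
  forall a b (g : hom (F a) (F b)), exists! f : hom a b, fmap F f = g.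

Definition isomorphism_functor {C D : category} (F : functor C D) : Prop :=
  (forall b : D, exists! a : C, F a = b) /\ fully_faithful F.

Definition full_subcategory (C : category) (P : C -> Prop) : category :=
  @Category {a : C | P a}
    (fun a b => hom (proj1_sig a) (proj1_sig b))
    (fun a => idm (proj1_sig a))
    (fun a b c f g => f ;; g)
    (fun a b f => comp_idl f)
    (fun a b f => comp_idr f)
    (fun a b c d f g h => comp_assoc f g h).

(** * Categories with subobjects *)

Record category_with_subobjects := CategoryWithSubobjects {
  cws_category :> category;
  inclusion : forall a b : cws_category, hom a b -> Prop;
  inclusion_id : forall a, inclusion (idm a);
  inclusion_comp : forall a b c (f : hom a b) (g : hom b c),
    inclusion f -> inclusion g -> inclusion (f ;; g);
  inclusion_thin : forall a b (f g : hom a b),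
    inclusion f -> inclusion g -> f = g;
  inclusion_iso : forall a b (f : hom a b) (g : hom b a),
    inclusion f -> inclusion g -> f ;; g = idm a -> g ;; f = idm b ->
    existT (hom a) b f = existT (hom a) a (idm a);
  inclusion_mono : forall a b (f : hom a b), inclusion f -> mono f;
  inclusion_cancel : forall a b c (h : hom a b) (g : hom b c),
    inclusion (h ;; g) -> inclusion g -> inclusion h }.

Arguments inclusion {_ _ _} _.

Section Subobjects.
Context {C : category_with_subobjects}.

Definition subobject (a b : C) : Prop := exists j : hom a b, inclusion j.

Definition retraction {a b : C} (q : hom a b) : Prop :=
  exists j : hom b a, inclusion j /\ j ;; q = idm b.

Definition consistent_factorisation {a b : C} (f : hom a b)
    (x y : C) (q : hom a x) (u : hom x y) (j : hom y b) : Prop :=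
  retraction q /\ bimorphism u /\ inclusion j /\ f = q ;; u ;; j.

Definition normal_factorisation {a b : C} (f : hom a b)
    (x y : C) (q : hom a x) (u : hom x y) (j : hom y b) : Prop :=
  retraction q /\ iso u /\ inclusion j /\ f = q ;; u ;; j.

Definition epimorphic_component_of {a b : C} (f : hom a b)
    (e : {y : C & hom a y}) : Prop :=
  exists x (q : hom a x) (u : hom x (projT1 e)) (j : hom (projT1 e) b),
    consistent_factorisation f q u j /\ projT2 e = q ;; u.

(* The epimorphic component of f, together with its codomain; when f has no
   consistent factorisation the value is arbitrary. *)
Definition epimorphic_component {a b : C} (f : hom a b) : {y : C & hom a y} :=
  epsilon (inhabits (existT (hom a) a (idm a))) (epimorphic_component_of f).

Definition im {a b : C} (f : hom a b) : C := projT1 (epimorphic_component f).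

Definition epic {a b : C} (f : hom a b) : hom a (im f) :=
  projT2 (epimorphic_component f).

Definition ideal (c : C) : category :=
  full_subcategory (fun a : C => subobject a c).

Inductive core_hom (c : C) : forall a b : C, hom a b -> Prop :=
| core_inclusion (a b : C) (f : hom a b) :
    subobject a c -> subobject b c -> inclusion f -> core_hom c f
| core_retraction (a b : C) (f : hom a b) :
    subobject a c -> subobject b c -> retraction f -> core_hom c f
| core_comp (a b d : C) (f : hom a b) (g : hom b d) :
    core_hom c f -> core_hom c g -> core_hom c (f ;; g).

Lemma sig_eq (T : Type) (P : T -> Prop) (x y : {t | P t}) :
  proj1_sig x = proj1_sig y -> x = y.
Proof.
destruct x as [x px], y as [y py]; simpl; intros <-.
now rewrite (proof_irrelevance _ px py).
Qed.

(* The subcategory <c>: its objects are the subobjects of c and its morphisms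
   are the composites of inclusions and retractions among them. *)
Definition core_category (c : C) : category.
Proof.
refine (@Category {a : C | subobject a c}
  (fun a b => {f : hom (proj1_sig a) (proj1_sig b) | core_hom c f})
  (fun a => exist _ (idm (proj1_sig a))
     (core_inclusion (proj2_sig a) (proj2_sig a) (inclusion_id _)))
  (fun a b d f g => exist _ (proj1_sig f ;; proj1_sig g)
     (core_comp (proj2_sig f) (proj2_sig g)))
  _ _ _); intros; apply sig_eq; simpl.
- apply comp_idl.
- apply comp_idr.
- apply comp_assoc.
Defined.

(* The functor T extends T^u, and restricting u to the subobjects of its domain
   is natural: the component at c' is the epimorphic component
   c' -> T(c') = im(j u) of j u, where j : c' -> c is the inclusion.  These
   components are bimorphisms, invertible only when the factorisation of j u
   is normal, so invertibility is not required of them. *)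
Definition extends_along {c d : C} (u : hom c d)
    (T : functor (core_category c) (core_category d)) : Prop :=
  isomorphism_functor T /\
  (forall (a : core_category c) (j : hom (proj1_sig a) c),
     inclusion j -> proj1_sig (T a) = im (j ;; u)) /\
  (forall (a b : core_category c) (j : hom a b),
     inclusion (proj1_sig j) -> inclusion (proj1_sig (fmap T j))) /\
  exists eta : forall a : core_category c,
      hom (proj1_sig a) (proj1_sig (T a)),
    (forall (a : core_category c) (j : hom (proj1_sig a) c), inclusion j ->
       epimorphic_component (j ;; u) =
         existT (hom (proj1_sig a)) (proj1_sig (T a)) (eta a)) /\
    (forall (a b : core_category c) (h : hom a b),
       proj1_sig h ;; eta b = eta a ;; proj1_sig (fmap T h)).

Definition consistent_bimorphism {c d : C} (u : hom c d) : Prop :=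
  exists! T : functor (core_category c) (core_category d), extends_along u T.

End Subobjects.

(** * Cones *)

Record cone (C : category_with_subobjects) (c : C) := Cone {
  leg :> forall a : C, hom a c;
  leg_compatible : forall (a b : C) (j : hom a b),
    inclusion j -> j ;; leg b = leg a }.

(* Cones with arbitrary apex. *)
Definition cones (C : category_with_subobjects) : Type := {c : C & cone c}.

Section Cones.
Context {C : category_with_subobjects}.

Definition consistent_cone {c : C} (g : cone c) : Prop :=
  exists a, bimorphism (g a).

Definition idempotent_cone {c : C} (e : cone c) : Prop :=
  consistent_cone e /\ e c = idm c.

Definition star {c d : C} (g : cone c) (f : hom c d) : cone d.
Proof.
refine (@Cone C d (fun a => g a ;; f) _).
intros a b j Hj; rewrite comp_assoc.
now rewrite (leg_compatible g Hj).
Defined.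

(* The cone g * f° with apex im f. *)
Definition star_epic {c d : C} (g : cone c) (f : hom c d) : cones C :=
  existT _ (im f) (star g (epic f)).

Definition cone_mul (g h : cones C) : cones C :=
  star_epic (projT2 g) (projT2 h (projT1 g)).

End Cones.

Record consistent_category := ConsistentCategory {
  cc_category :> category_with_subobjects;
  cc_split : forall (a b : cc_category) (j : hom a b),
    inclusion j -> exists q : hom b a, j ;; q = idm a;
  cc_factorisation : forall (a b : cc_category) (f : hom a b),
    exists x y (q : hom a x) (u : hom x y) (j : hom y b),
      consistent_factorisation f q u j;
  cc_bimorphism : forall (a b : cc_category) (u : hom a b),
    bimorphism u -> consistent_bimorphism u;
  cc_normal : forall (a b c : cc_category) (j : hom a b) (q : hom b c),
    inclusion j -> retraction q ->
    exists x y (q' : hom a x) (u : hom x y) (j' : hom y c),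
      normal_factorisation (j ;; q) q' u j';
  cc_cone : forall c : cc_category,
    exists e : cone c, consistent_cone e /\ e c = idm c }.

(** * The consistent dual *)

(* The category of subsets of U and all maps between them: the part of Set in
   which the functors H(e;-) take their values. *)
Definition subsets (U : Type) : category :=
  @Category (U -> Prop) (fun A B => {x | A x} -> {x | B x})
    (fun A x => x) (fun A B D f g x => g (f x))
    (fun A B f => eq_refl) (fun A B f => eq_refl)
    (fun A B D E f g h => eq_refl).

Record nat_trans (C D : category) (F G : functor C D) := NatTrans {
  component :> forall a : C, hom (F a) (G a);
  naturality : forall (a b : C) (f : hom a b),
    fmap F f ;; component b = component a ;; fmap G f }.

Lemma nat_trans_eq (C D : category) (F G : functor C D) (s t : nat_trans F G) :
  (forall a, s a = t a) -> s = t.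
Proof.
destruct s as [s ps], t as [t pt]; simpl; intros E.
assert (Est : s = t) by (now apply functional_extensionality_dep).
subst t; now rewrite (proof_irrelevance _ ps pt).
Qed.

Definition functor_category (C D : category) : category.
Proof.
refine (@Category (functor C D) (@nat_trans C D)
  (fun F => @NatTrans C D F F (fun a => idm (F a)) _)
  (fun F G H s t => @NatTrans C D F H (fun a => s a ;; t a) _) _ _ _).
- intros F G s; apply nat_trans_eq; intros a; apply comp_idl.
- intros F G s; apply nat_trans_eq; intros a; apply comp_idr.
- intros F G H K r s t; apply nat_trans_eq; intros a; apply comp_assoc.
Unshelve.
+ intros a b f; now rewrite comp_idl, comp_idr.
+ intros a b f; rewrite comp_assoc, naturality, <- comp_assoc, naturality.
  apply comp_assoc.
Defined.

Section HFunctor.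
Context {C : consistent_category}.

Lemma epimorphic_componentP {a b : C} (f : hom a b) :
  epimorphic_component_of f (epimorphic_component f).
Proof.
unfold epimorphic_component; apply epsilon_spec.
destruct (cc_factorisation f) as (x & y & q & u & j & F).
exists (existT _ y (q ;; u)), x, q, u, j; now split.
Qed.

Lemma epimorphic_component_inj {a b : C} (f g : hom a b) :
  epimorphic_component f = epimorphic_component g -> f = g.
Proof.
destruct (epimorphic_componentP f) as (x & q & u & j & (_ & _ & Hj & Ef) & E).
destruct (epimorphic_componentP g) as (y & p & v & k & (_ & _ & Hk & Eg) & F).
rewrite <- E in Ef; rewrite <- F in Eg; clear E F.
generalize dependent k; generalize dependent j.
destruct (epimorphic_component f) as [y1 e1].
destruct (epimorphic_component g) as [y2 e2]; simpl.
intros j Hj Ef k Hk Eg E; injection E; intros _ Ey; subst y2.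
apply inj_pair2 in E; subst e2.
now rewrite Ef, Eg, (inclusion_thin Hj Hk).
Qed.

Context {c : C} {e : cone c} (idem : idempotent_cone e).

Lemma star_epic_inj (d : C) (f g : hom c d) :
  star_epic e f = star_epic e g -> f = g.
Proof using idem.
intros E; apply epimorphic_component_inj.
assert (E' := f_equal (fun g : cones C =>
  existT (hom c) (projT1 g) (projT2 g c)) E).
simpl in E'; rewrite (proj2 idem), !comp_idl in E'.
now unfold epic, im in E'; rewrite <- !sigT_eta in E'.
Qed.

Definition H_set (d : C) (x : cones C) : Prop :=
  exists f : hom c d, x = star_epic e f.

Definition H_map (a b : C) (g : hom a b) (x : {x | H_set a x}) :
    {x | H_set b x} :=
  let f := proj1_sig (constructive_indefinite_description _ (proj2_sig x)) in
  exist _ (star_epic e (f ;; g)) (ex_intro _ (f ;; g) eq_refl).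

Lemma H_mapE (a b : C) (g : hom a b) (x : {x | H_set a x}) (f : hom c a) :
  proj1_sig x = star_epic e f -> proj1_sig (H_map g x) = star_epic e (f ;; g).
Proof using idem.
intros E; unfold H_map; simpl.
destruct constructive_indefinite_description as [f' E']; simpl.
now rewrite (star_epic_inj (eq_trans (eq_sym E) E')).
Qed.

Definition H_functor : functor C (subsets (cones C)).
Proof using idem.
refine (@Functor C (subsets (cones C)) H_set H_map _ _).
- intros a; apply functional_extensionality; intros [x [f E]]; apply sig_eq.
  rewrite (@H_mapE a a (idm a) (exist _ x (ex_intro _ f E)) f E), comp_idr.
  now symmetry.
- intros a b d f g; apply functional_extensionality; intros [x [h E]].
  apply sig_eq; set (X := exist _ x (ex_intro _ h E)).
  rewrite (@H_mapE a d (f ;; g) X h E), comp_assoc; symmetry.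
  exact (@H_mapE b d g (H_map f X) (h ;; f) (@H_mapE a b f X h E)).
Defined.

End HFunctor.

Section Dual.
Variable C : consistent_category.

Definition is_H (F : functor_category C (subsets (cones C))) : Prop :=
  exists (c : C) (e : cone c) (idem : idempotent_cone e), F = H_functor idem.

Definition dual_category : category := full_subcategory is_H.

Definition subfunctor_inclusion (F G : dual_category) (s : hom F G) : Prop :=
  forall (a : C) (x : {x | proj1_sig F a x}),
    proj1_sig (component s a x) = proj1_sig x.

Lemma subfunctor_inclusion_thin (F G : dual_category) (s t : hom F G) :
  subfunctor_inclusion s -> subfunctor_inclusion t -> s = t.
Proof.
intros Hs Ht; apply nat_trans_eq; intros a; apply functional_extensionality.
now intros x; apply sig_eq; rewrite Hs, Ht.
Qed.

Lemma functor_subsets_eq (U : Type) (F G : functor C (subsets U))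
    (s : nat_trans F G) (t : nat_trans G F) :
  (forall a x, proj1_sig (s a x) = proj1_sig x) ->
  (forall a x, proj1_sig (t a x) = proj1_sig x) -> F = G.
Proof.
destruct F as [F mF iF cF], G as [G mG iG cG].
destruct s as [s ns], t as [t nt]; simpl in *; intros Hs Ht.
assert (E : F = G).
{ apply functional_extensionality; intros a.
  apply functional_extensionality; intros x.
  apply propositional_extensionality; split; intros Hx.
  - rewrite <- (Hs a (exist _ x Hx) : _ = x); apply proj2_sig.
  - rewrite <- (Ht a (exist _ x Hx) : _ = x); apply proj2_sig. }
subst G.
assert (Es : forall a x, s a x = x) by (now intros a x; apply sig_eq).
assert (E : mF = mG).
{ apply functional_extensionality_dep; intros a.
  apply functional_extensionality_dep; intros b.
  apply functional_extensionality; intros f.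
  apply functional_extensionality; intros x.
  generalize (f_equal (fun k => k x) (ns a b f)); simpl.
  now rewrite !Es. }
subst mG.
now rewrite (proof_irrelevance _ iF iG), (proof_irrelevance _ cF cG).
Qed.

Definition dual : category_with_subobjects.
Proof.
refine (@CategoryWithSubobjects dual_category subfunctor_inclusion _ _ _ _ _ _).
- now intros F a x.
- intros F G H s t Hs Ht a x; simpl; now rewrite Ht, Hs.
- exact subfunctor_inclusion_thin.
- intros F G s t Hs Ht _ _.
  assert (E : F = G) by (apply sig_eq; exact (functor_subsets_eq Hs Ht)).
  subst G; f_equal; apply subfunctor_inclusion_thin; [assumption|].
  now intros a x.
- intros F G s Hs H t t' E; apply nat_trans_eq; intros a.
  apply functional_extensionality; intros x; apply sig_eq.
  assert (Ea := f_equal (fun k : hom H G => component k a) E).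
  assert (Ex := f_equal (fun k => proj1_sig (k x)) Ea).
  exact (eq_trans (eq_sym (Hs a _)) (eq_trans Ex (Hs a _))).
- intros F G H s t Hst Ht a x; rewrite <- (Hst a x); simpl.
  now rewrite Ht.
Defined.

End Dual.

(* c belongs to MH(e;-) for F = H(e;-). *)
Definition M_set {C : consistent_category} (F : dual C) (c : C) : Prop :=
  exists (a : C) (e : cone a) (idem : idempotent_cone e),
    proj1_sig F = H_functor idem /\ iso (e c).

(** * Cross-connections *)

Definition inclusion_preserving {C D : category_with_subobjects}
    (F : functor C D) : Prop :=
  forall (a b : C) (j : hom a b), inclusion j -> inclusion (fmap F j).

Definition restrict_ideal {C D : category_with_subobjects} (F : functor C D)
    (incl : inclusion_preserving F) (c : C) : functor (ideal c) (ideal (F c)) :=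
  @Functor (ideal c) (ideal (F c))
    (fun a => exist (fun b => subobject b (F c)) (F (proj1_sig a))
       match proj2_sig a with
       | ex_intro _ j Hj => ex_intro _ (fmap F j) (incl _ _ j Hj)
       end)
    (fun a b f => fmap F (f : hom (proj1_sig a) (proj1_sig b)))
    (fun a => fmap_id F (proj1_sig a))
    (fun a b d f g => fmap_comp F f g).

Definition local_isomorphism {C D : category_with_subobjects}
    (F : functor C D) : Prop :=
  exists incl : inclusion_preserving F,
    fully_faithful F /\ forall c, isomorphism_functor (restrict_ideal incl c).

Record cross_connection := CrossConnection {
  xcC : consistent_category;
  xcD : consistent_category;
  Gamma : functor xcD (dual xcC);
  Delta : functor xcC (dual xcD);
  Gamma_local : local_isomorphism Gamma;
  Delta_local : local_isomorphism Delta;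
  Gamma_Delta : forall (c : xcC) (d : xcD),
    M_set (Gamma d) c <-> M_set (Delta c) d }.

(** * Semigroups and regular biordered sets *)

(* Semigroups are given as subsets of a type carrying a total operation. *)
Section Semigroups.
Context {U : Type} (op : U -> U -> U).

Definition is_semigroup (S : U -> Prop) : Prop :=
  (forall x y, S x -> S y -> S (op x y)) /\
  (forall x y z, S x -> S y -> S z -> op x (op y z) = op (op x y) z).

Definition idempotent_in (S : U -> Prop) (e : U) : Prop := S e /\ op e e = e.

Inductive generated (A : U -> Prop) : U -> Prop :=
| generated_in x : A x -> generated A x
| generated_op x y :
    generated A x -> generated A y -> generated A (op x y).

Definition regular (A : U -> Prop) : Prop :=
  forall x, A x -> exists y, A y /\ op (op x y) x = x.

(* The subsemigroup <e> of S. *)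
Definition core_semigroup (S : U -> Prop) (e : U) : U -> Prop :=
  generated (fun g => idempotent_in S g /\ op g e = g /\ op e g = g).

Definition semigroup_isomorphism (A B : U -> Prop) (h : U -> U) : Prop :=
  (forall x, A x -> B (h x)) /\
  (forall y, B y -> exists! x, A x /\ h x = y) /\
  (forall x y, A x -> A y -> h (op x y) = op (h x) (h y)).

Section Biorder.
Context {V : Type} (i : V -> U).

(* V is identified, through i, with the set of idempotents of the semigroup S,
   and these generate a regular subsemigroup. *)
Definition regular_biordered_set (S : U -> Prop) : Prop :=
  is_semigroup S /\
  (forall e f, i e = i f -> e = f) /\
  (forall x, idempotent_in S x <-> exists e, i e = x) /\
  regular (generated (idempotent_in S)).

Definition omega_l (e f : V) : Prop := op (i e) (i f) = i e.
Definition omega_r (e f : V) : Prop := op (i f) (i e) = i e.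
Definition omega (e f : V) : Prop := omega_l e f /\ omega_r e f.
Definition L_rel (e f : V) : Prop := omega_l e f /\ omega_l f e.
Definition R_rel (e f : V) : Prop := omega_r e f /\ omega_r f e.

(* [e f; g h] is a singular square (rows e f and g h). *)
Definition singular_square (e f g h : V) : Prop :=
  (exists k, omega_l e k /\ omega_l f k /\ R_rel e f /\
     i g = op (i k) (i e) /\ i h = op (i k) (i f)) \/
  (exists k, omega_r e k /\ omega_r g k /\ L_rel e g /\
     i f = op (i e) (i k) /\ i h = op (i g) (i k)).

End Biorder.
End Semigroups.

(** * Ordered and inductive cancellative categories *)

Record arrow (I : category) := Arrow {
  adom : I;
  acod : I;
  amor :> hom adom acod }.

Arguments Arrow {I adom acod}.

Record ordered_cancellative (I : category) (le : relation (arrow I)) : Prop := {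
  oc_order : order (arrow I) le;
  occ1 : forall (a b : I) (u : hom a b), bimorphism u;
  occ2 : forall (a b c a' b' c' : I) (u : hom a b) (v : hom b c)
      (x : hom a' b') (y : hom b' c'),
    le (Arrow u) (Arrow x) -> le (Arrow v) (Arrow y) ->
    le (Arrow (u ;; v)) (Arrow (x ;; y));
  occ3 : forall x y : arrow I, le x y ->
    le (Arrow (idm (adom x))) (Arrow (idm (adom y))) /\
    le (Arrow (idm (acod x))) (Arrow (idm (acod y)));
  occ4 : forall (x : arrow I) (e : I),
    le (Arrow (idm e)) (Arrow (idm (adom x))) ->
    exists! y, le y x /\ adom y = e;
  occ5 : forall (x : arrow I) (f : I),
    le (Arrow (idm f)) (Arrow (idm (acod x))) ->
    exists! y, le y x /\ acod y = f }.

(* The objects of I form a regular biordered set through i, and [dist e f m]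
   means that m is the distinguished morphism [e,f].  By OCC4 the restriction
   of x to e is the x1 : e -> f with x1 <= x, which is also the corestriction
   of x to f.  The "duals" of ICC1 are taken both with respect to exchanging
   omega_l and omega_r and with respect to exchanging restrictions and
   corestrictions. *)
Record inductive_cancellative (I : category) (le : relation (arrow I))
    (U : Type) (op : U -> U -> U) (S : U -> Prop) (i : I -> U)
    (dist : forall e f : I, hom e f -> Prop) : Prop := {
  ic_ordered : ordered_cancellative le;
  ic_biordered : regular_biordered_set op i S;
  ic_omega : forall e f : I,
    omega op i e f <-> le (Arrow (idm e)) (Arrow (idm f));
  ic_dist_dom : forall (e f : I) (m : hom e f),
    dist e f m -> R_rel op i e f \/ L_rel op i e f;
  ic_dist_ex : forall e f : I,
    R_rel op i e f \/ L_rel op i e f -> exists! m, dist e f m;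
  ic_dist_id : forall e : I, dist e e (idm e);
  ic_dist_comp : forall (e f g : I) (m : hom e f) (n : hom f g),
    (R_rel op i e f /\ R_rel op i f g) \/ (L_rel op i e f /\ L_rel op i f g) ->
    dist e f m -> dist f g n -> dist e g (m ;; n);
  ic_dist_le : forall (g h e : I) (m : hom g h),
    dist g h m -> omega op i e g ->
    exists (f : I) (n : hom e f),
      i f = op (op (i h) (i e)) (i h) /\ dist e f n /\
      le (Arrow n) (Arrow m);
  icc1_restriction_r : forall (a b e1 f1 e2 f2 : I)
      (x : hom a b) (x1 : hom e1 f1) (x2 : hom e2 f2),
    le (Arrow x1) (Arrow x) -> le (Arrow x2) (Arrow x) ->
    omega_r op i e1 e2 ->
    omega_r op i f1 f2 /\
    exists (e f : I) (y : hom e f) (m : hom e1 e) (n : hom f1 f),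
      i e = op (i e1) (i e2) /\ i f = op (i f1) (i f2) /\
      le (Arrow y) (Arrow x) /\ dist e1 e m /\ dist f1 f n /\
      m ;; y = x1 ;; n;
  icc1_restriction_l : forall (a b e1 f1 e2 f2 : I)
      (x : hom a b) (x1 : hom e1 f1) (x2 : hom e2 f2),
    le (Arrow x1) (Arrow x) -> le (Arrow x2) (Arrow x) ->
    omega_l op i e1 e2 ->
    omega_l op i f1 f2 /\
    exists (e f : I) (y : hom e f) (m : hom e1 e) (n : hom f1 f),
      i e = op (i e2) (i e1) /\ i f = op (i f2) (i f1) /\
      le (Arrow y) (Arrow x) /\ dist e1 e m /\ dist f1 f n /\
      m ;; y = x1 ;; n;
  icc1_corestriction_r : forall (a b e1 f1 e2 f2 : I)
      (x : hom a b) (x1 : hom e1 f1) (x2 : hom e2 f2),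
    le (Arrow x1) (Arrow x) -> le (Arrow x2) (Arrow x) ->
    omega_r op i f1 f2 ->
    omega_r op i e1 e2 /\
    exists (e f : I) (y : hom e f) (m : hom e1 e) (n : hom f1 f),
      i e = op (i e1) (i e2) /\ i f = op (i f1) (i f2) /\
      le (Arrow y) (Arrow x) /\ dist e1 e m /\ dist f1 f n /\
      m ;; y = x1 ;; n;
  icc1_corestriction_l : forall (a b e1 f1 e2 f2 : I)
      (x : hom a b) (x1 : hom e1 f1) (x2 : hom e2 f2),
    le (Arrow x1) (Arrow x) -> le (Arrow x2) (Arrow x) ->
    omega_l op i f1 f2 ->
    omega_l op i e1 e2 /\
    exists (e f : I) (y : hom e f) (m : hom e1 e) (n : hom f1 f),
      i e = op (i e2) (i e1) /\ i f = op (i f2) (i f1) /\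
      le (Arrow y) (Arrow x) /\ dist e1 e m /\ dist f1 f n /\
      m ;; y = x1 ;; n;
  icc2 : forall (e f g h : I) (ef : hom e f) (fh : hom f h)
      (eg : hom e g) (gh : hom g h),
    singular_square op i e f g h ->
    dist e f ef -> dist f h fh -> dist e g eg -> dist g h gh ->
    ef ;; fh = eg ;; gh }.

(** * The cross-connection semigroup and the category I(Omega) *)

Section CrossConnectionSemigroup.
Variable Om : cross_connection.
Notation C := (xcC Om).
Notation D := (xcD Om).

Lemma inhabited_cone (K : consistent_category) (c : K) : inhabited (cone c).
Proof. now destruct (cc_cone c) as [e _]; constructor. Qed.

(* The idempotent cone with apex c and H(gamma(c,d);-) = Gamma(d); meaningful
   when (c,d) lies in E_Omega. *)
Definition gamma_cone (c : C) (d : D) : cone c :=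
  epsilon (inhabited_cone c) (fun e =>
    exists idem : idempotent_cone e, H_functor idem = proj1_sig (Gamma Om d)).

Definition delta_cone (c : C) (d : D) : cone d :=
  epsilon (inhabited_cone d) (fun e =>
    exists idem : idempotent_cone e, H_functor idem = proj1_sig (Delta Om c)).

(* g is the transpose of f, relative to d in M Delta(c') and d' in M Delta(c):
   evaluated at k, the equation D(g,-) = eta^-1 Delta(f) eta says that Delta(f)
   maps delta(c',d) * k° to delta(c,d') * (g k)°. *)
Definition is_transpose (c' c : C) (d d' : D) (f : hom c' c) (g : hom d' d) :
    Prop :=
  forall (b : D) (k : hom d b) (x : {x | proj1_sig (Delta Om c') b x}),
    proj1_sig x = star_epic (delta_cone c' d) k ->
    proj1_sig (component (fmap (Delta Om) f) b x) =
      star_epic (delta_cone c d') (g ;; k).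

Definition Gamma_set (c : C) (d : D) : cones C -> Prop :=
  proj1_sig (Gamma Om d) c.

Definition Delta_set (c : C) (d : D) : cones D -> Prop :=
  proj1_sig (Delta Om c) d.

(* The graph of chi(c,d). *)
Definition chi (c : C) (d : D) (x : cones C) (y : cones D) : Prop :=
  exists (c' : C) (d' : D) (f : hom c' c) (g : hom d' d),
    M_set (Gamma Om d) c' /\ M_set (Delta Om c) d' /\
    is_transpose f g /\
    x = star_epic (gamma_cone c' d) f /\ y = star_epic (delta_cone c d') g.

(* Gamma and Delta are only related through their objects, so this has to be
   assumed: with Delta preceded by an automorphism of C fixing objects and
   inclusions, chi(c,d) need not be single-valued. *)
Definition chi_bijective : Prop :=
  forall (c : C) (d : D),
    (forall x y, chi c d x y -> Gamma_set c d x /\ Delta_set c d y) /\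
    (forall x, Gamma_set c d x -> exists! y, chi c d x y) /\
    (forall y, Delta_set c d y -> exists! x, chi c d x y).

Definition linked (p : cones C * cones D) : Prop :=
  exists (c : C) (d : D), chi c d (fst p) (snd p).

Definition linked_mul (p q : cones C * cones D) : cones C * cones D :=
  (cone_mul (fst p) (fst q), cone_mul (snd q) (snd p)).

Definition E_set : Type := {p : C * D | M_set (Gamma Om (snd p)) (fst p)}.

Definition Ec (e : E_set) : C := fst (proj1_sig e).
Definition Ed (e : E_set) : D := snd (proj1_sig e).

Definition E_gamma (e : E_set) : cone (Ec e) := gamma_cone (Ec e) (Ed e).
Definition E_delta (e : E_set) : cone (Ed e) := delta_cone (Ec e) (Ed e).

(* That E_Omega is, through this map, the regular biordered set of idempotents
   of the semigroup of linked pairs is likewise not automatic.  The Rees matrix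
   semigroup over (N,+) with sandwich matrix [0 1; 1 0] comes from a
   cross-connection of consistent categories without proper inclusions, and
   the product of its two idempotents is not regular. *)
Definition E_idempotent (e : E_set) : cones C * cones D :=
  (existT _ (Ec e) (E_gamma e), existT _ (Ed e) (E_delta e)).

Definition E_sub (e f : E_set) : Prop :=
  subobject (Ec e) (Ec f) /\ subobject (Ed e) (Ed f).

Definition E_core (e : E_set) : cones C * cones D -> Prop :=
  core_semigroup linked_mul linked (E_idempotent e).

Definition connecting_isomorphism (e f : E_set) (u : hom (Ec e) (Ec f))
    (ups : cones C * cones D -> cones C * cones D) : Prop :=
  exists ut : hom (Ed f) (Ed e),
    is_transpose u ut /\
    let x : cones C * cones D :=
      (existT _ (Ec f) (star (E_gamma e) u),
       existT _ (Ed e) (star (E_delta f) ut)) in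
    semigroup_isomorphism linked_mul (E_core e) (E_core f) ups /\
    forall y, E_core e y -> linked_mul y x = linked_mul x (ups y).

(* f1 = e1 ups, where ups is the connecting isomorphism of u. *)
Definition connects (e f : E_set) (u : hom (Ec e) (Ec f)) (e1 f1 : E_set) :
    Prop :=
  exists ups, connecting_isomorphism u ups /\
    ups (E_idempotent e1) = E_idempotent f1.

Definition I_category : category.
Proof.
refine (@Category E_set
  (fun e f => {u : hom (Ec e) (Ec f) | bimorphism u})
  (fun e => exist _ (idm (Ec e)) (bimorphism_id (Ec e)))
  (fun e f g u v => exist _ (proj1_sig u ;; proj1_sig v)
     (bimorphism_comp (proj2_sig u) (proj2_sig v))) _ _ _);
  intros; apply sig_eq; simpl.
- apply comp_idl.
- apply comp_idr.
- apply comp_assoc.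
Defined.

(* v = (j u)°, where j is the inclusion of c(e1) in c(e). *)
Definition is_cut (e f e1 f1 : E_set)
    (u : hom (Ec e) (Ec f)) (v : hom (Ec e1) (Ec f1)) : Prop :=
  exists j : hom (Ec e1) (Ec e), inclusion j /\
    epimorphic_component (j ;; u) = existT (hom (Ec e1)) (Ec f1) v.

Definition I_le (u1 u2 : arrow I_category) : Prop :=
  E_sub (adom u1) (adom u2) /\
  is_cut (proj1_sig (amor u2)) (proj1_sig (amor u1)) /\
  connects (proj1_sig (amor u2)) (adom u1) (acod u1).

Definition I_distinguished (e f : I_category) (m : hom e f) : Prop :=
  (R_rel linked_mul E_idempotent e f \/ L_rel linked_mul E_idempotent e f) /\
  proj1_sig m = E_gamma f (Ec e).

Definition I_restrictions : Prop :=
  forall (e f e1 : I_category) (u : hom e f), E_sub e1 e ->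
    exists (f1 : I_category) (v : hom e1 f1),
      is_cut (proj1_sig u) (proj1_sig v) /\ I_le (Arrow v) (Arrow u).

Definition I_corestrictions : Prop :=
  forall (e f f1 : I_category) (u : hom e f), E_sub f1 f ->
    exists (e1 : I_category) (v : hom e1 f1),
      connects (proj1_sig u) e1 f1 /\
      is_cut (proj1_sig u) (proj1_sig v) /\ I_le (Arrow v) (Arrow u).

End CrossConnectionSemigroup.

(* Main.v *)
From Stdlib Require Import ClassicalEpsilon FunctionalExtensionality
  PropExtensionality ProofIrrelevance Relations.
Require Import Defs.

Set Implicit Arguments.
Unset Strict Implicit.
Unset Printing Implicit Defensive.

(** Write e = (c_e,d_e) for an element of E_Omega, gamma_e and delta_e for its
    two idempotent cones, h° for the epimorphic component of h and h‡ for its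
    transpose.  To a morphism h : c_e -> c_f of C attach the linked pair
    X(h) = (gamma_e * h°, delta_f * (h‡)°).  Products of such pairs are pairs of
    composites, X(1) = e, and X is injective between given idempotents, so that
    I(Omega) is represented faithfully inside the semigroup S of linked pairs.
    All of its structure can then be read off in S:
    - u1 <= u2, for u1 : e1 -> f1 and u2 : e -> f, holds exactly when
      e1 omega e, f1 omega f and X(u1) = e1 X(u2) = X(u2) f1 ([I_leE]);
    - the distinguished morphism from e to f is the m with X(m) = ef
      ([I_distinguishedE]).
    With these descriptions the axioms are computations with idempotents, in
    which the equations s X(u) = X(u) t carry relations between elements below
    the domain to relations between elements below the codomain, and back
    ([semigroup_inductive_cancellative]).

    The first thing to prove is that ef = X(gamma_f(c_e)), which says that the
    transpose of gamma_f(c_e) is delta_e(d_f) ([all_compatible]).  For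
    c_e contained in c_f this holds because Delta preserves inclusions, and for
    d_e = d_f because chi(c_f,d_e) is single-valued.  For e, f with f below
    e it comes from an idempotent endomorphism of c_e, which has to be f because
    Gamma is injective on ideals.  The property is inherited by e and g from the
    pairs e, h and h, g whenever eg = ehg; products of two idempotents
    extend it to e and g comparable under one of omega^l, omega^r, and a sandwich
    element h extends it to arbitrary e and g, which is where regularity of the
    subsemigroup generated by the idempotents enters.

    The second thing is that restrictions, corestrictions and connecting
    isomorphisms exist.  For a bimorphism u : c_e -> c_f, the isomorphism of core
    categories that makes u consistent moves a subobject of c_e, together with a
    retraction onto it, to a subobject of c_f with a retraction
    ([bimorphism_image]), and conversely ([bimorphism_preimage]).  A subobject
    with a retraction is an idempotent endomorphism, hence an idempotent of S
    below e or f, so that to each e1 below e corresponds an f1 below f with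
    e1 X(u) = X(u) f1, and vice versa ([pair_restriction],
    [pair_corestriction]).  Cancelling X(u), the correspondence extends to an
    isomorphism of the generated subsemigroups
    ([connecting_isomorphism_exists]). *)

(** * Factorisations and cones in a consistent category *)

Lemma retraction_epi (C : category_with_subobjects) (a b : C) (q : hom a b) :
  retraction q -> epi q.
Proof.
intros (i & _ & E) z g h H.
now rewrite <- (comp_idl g), <- (comp_idl h), <- E, <- !comp_assoc, H.
Qed.

Lemma inclusion_antisym (C : category_with_subobjects) (a b : C)
    (f : hom a b) (g : hom b a) :
  inclusion f -> inclusion g -> existT (hom a) b f = existT (hom a) a (idm a).
Proof.
intros Hf Hg; apply inclusion_iso with g; trivial;
  apply inclusion_thin; auto using inclusion_comp, inclusion_id.
Qed.

Lemma inclusion_section (C : category_with_subobjects) (a b : C)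
    (f : hom a b) (g : hom b a) :
  inclusion f -> inclusion g -> f ;; g = idm a.
Proof.
intros Hf Hg; apply inclusion_thin; auto using inclusion_comp, inclusion_id.
Qed.

Section Factorisation.
Context {C : consistent_category}.

Lemma epicP {a b : C} (f : hom a b) :
  exists j : hom (im f) b, inclusion j /\ epi (epic f) /\ f = epic f ;; j.
Proof.
destruct (epimorphic_componentP f)
  as (x & q & u & j & (Hq & [_ Hu] & Hj & E) & E').
exists j; unfold im, epic; rewrite E'; repeat split; trivial.
intros z g h H; apply Hu, (retraction_epi Hq).
now rewrite !comp_assoc.
Qed.

Lemma epicE {a b : C} (f : hom a b) (j : hom (im f) b) :
  inclusion j -> epic f ;; j = f.
Proof.
intros Hj; destruct (epicP f) as (k & Hk & _ & E).
now rewrite (inclusion_thin Hj Hk).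
Qed.

Lemma epimorphic_component_spec {a b y : C} (f : hom a b) (e : hom a y) :
  epimorphic_component f = existT (hom a) y e ->
  epi e /\ exists j : hom y b, inclusion j /\ f = e ;; j.
Proof.
destruct (epicP f) as (j & Hj & He & E); revert j Hj He E.
unfold im, epic; generalize (epimorphic_component f).
intros p j Hj He E ->; simpl in *; eauto.
Qed.

(** Since j' splits by some r, the equation gives e j r j' = e j, and cancelling
    e makes j r a factor of the inclusion j, hence itself an inclusion. *)
Lemma inclusion_of_images (a x y b : C) (e : hom a x) (j : hom x b)
    (e' : hom a y) (j' : hom y b) :
  epi e -> inclusion j -> inclusion j' -> e ;; j = e' ;; j' ->
  exists m : hom x y, inclusion m /\ m ;; j' = j.
Proof.
intros He Hj Hj' E; destruct (cc_split Hj') as [r Hr].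
assert (Em : (j ;; r) ;; j' = j).
{ apply He; rewrite !comp_assoc, E.
  now rewrite <- (comp_assoc e'), Hr, comp_idr. }
exists (j ;; r); split; trivial.
apply (@inclusion_cancel C _ _ _ (j ;; r) j'); rewrite ?Em; trivial.
Qed.

(** The images of two factorisations into an epimorphism and an inclusion
    include each other, hence coincide. *)
Lemma epimorphic_component_unique (a y b : C) (f : hom a b) (e : hom a y)
    (j : hom y b) :
  epi e -> inclusion j -> f = e ;; j ->
  epimorphic_component f = existT (hom a) y e.
Proof.
intros He Hj E; destruct (epicP f) as (k & Hk & Hf & E').
rewrite (sigT_eta (epimorphic_component f)).
change (existT (hom a) (im f) (epic f) = existT (hom a) y e).
assert (Ek : epic f ;; k = e ;; j) by congruence; clear E E'.
revert k Hk Hf Ek; generalize (epic f); generalize (im f).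
intros x g k Hk Hg Ek.
destruct (inclusion_of_images Hg Hk Hj Ek) as (m & Hm & Em).
destruct (inclusion_of_images He Hj Hk (eq_sym Ek)) as (n & Hn & En).
assert (Eq := inclusion_antisym Hm Hn).
injection Eq; intros _ ->.
rewrite (inclusion_thin Hk Hj) in Ek.
now rewrite (inclusion_mono Hj Ek).
Qed.

Lemma epimorphic_component_epi (a b : C) (f : hom a b) :
  epi f -> epimorphic_component f = existT (hom a) b f.
Proof.
intros Hf; apply epimorphic_component_unique with (idm b); trivial.
- apply inclusion_id.
- now rewrite comp_idr.
Qed.

Lemma epimorphic_component_inclusion (a b d : C) (f : hom a b) (j : hom b d) :
  inclusion j -> epimorphic_component (f ;; j) = epimorphic_component f.
Proof.
intros Hj; destruct (epicP f) as (k & Hk & Hf & E).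
rewrite (sigT_eta (epimorphic_component f)).
apply epimorphic_component_unique with (k ;; j); trivial.
- now apply inclusion_comp.
- fold (epic f); now rewrite comp_assoc, <- E.
Qed.

Lemma cone_eq (c : C) (g h : cone c) : (forall a, g a = h a) -> g = h.
Proof.
destruct g as [g pg], h as [h ph]; simpl; intros E.
assert (Egh : g = h) by now apply functional_extensionality_dep.
subst h; now rewrite (proof_irrelevance _ pg ph).
Qed.

Lemma cones_eq (c d : C) (g : cone c) (h : cone d) (m : hom c d) (n : hom d c) :
  inclusion m -> inclusion n -> (forall a, g a ;; m = h a) ->
  existT (@cone C) c g = existT (@cone C) d h.
Proof.
intros Hm Hn E; assert (Eq := inclusion_antisym Hm Hn).
injection Eq; intros _ ->; f_equal; apply cone_eq; intros a.
rewrite <- E, (inclusion_thin Hm (inclusion_id _)); symmetry; apply comp_idr.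
Qed.

(** One epimorphic leg is enough to cancel [g] from composites [g a ;; f], and
    the property is preserved by composition with any epimorphism. *)
Definition epi_cone {c : C} (g : cone c) : Prop := exists a, epi (g a).

Lemma epi_cone_star (c d : C) (g : cone c) (f : hom c d) :
  epi_cone g -> epi f -> epi_cone (star g f).
Proof.
intros [a Ha] Hf; exists a; intros z h k E; simpl in E.
now apply Hf, Ha; rewrite !comp_assoc.
Qed.

Lemma idempotent_epi_cone (c : C) (g : cone c) : idempotent_cone g -> epi_cone g.
Proof. intros [[a [_ H]] _]; now exists a. Qed.

(** The image of f can be recovered from the composites [g a ;; f], because
    some leg of [g] is an epimorphism.  Equality of the cones g * f°, which may
    have different apices, thus reduces to equations between morphisms with a
    common codomain. *)
Lemma star_epic_eq (c c' b : C) (g : cone c) (g' : cone c') (f : hom c b)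
    (f' : hom c' b) :
  epi_cone g -> epi_cone g' -> (forall a, g a ;; f = g' a ;; f') ->
  star_epic g f = star_epic g' f'.
Proof.
intros Hg Hg' E; unfold star_epic.
destruct (epicP f) as (j & Hj & He & Ef).
destruct (epicP f') as (j' & Hj' & He' & Ef').
destruct (epi_cone_star Hg He) as [a Ha].
destruct (epi_cone_star Hg' He') as [a' Ha'].
assert (Ea : forall a, star g (epic f) a ;; j = star g' (epic f') a ;; j').
{ intros z; simpl; rewrite <- !comp_assoc, <- Ef, <- Ef'; apply E. }
destruct (inclusion_of_images Ha Hj Hj' (Ea a)) as (m & Hm & Em).
destruct (inclusion_of_images Ha' Hj' Hj (eq_sym (Ea a'))) as (n & Hn & En).
apply cones_eq with m n; trivial.
intros z; apply (inclusion_mono Hj').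
now rewrite <- comp_assoc, Em.
Qed.

Lemma star_epic_leg (c b : C) (g : cone c) (f : hom c b) (x : cones C)
    (j : hom (projT1 x) b) :
  star_epic g f = x -> inclusion j -> forall a, g a ;; f = projT2 x a ;; j.
Proof.
intros <- Hj a; simpl; now rewrite <- comp_assoc, (epicE Hj).
Qed.

Lemma star_epic_legs (c c' b : C) (g : cone c) (g' : cone c') (f : hom c b)
    (f' : hom c' b) :
  star_epic g f = star_epic g' f' -> forall a, g a ;; f = g' a ;; f'.
Proof.
intros E a; destruct (epicP f') as (j & Hj & _ & Ef).
rewrite (star_epic_leg E Hj); simpl; now rewrite <- comp_assoc, <- Ef.
Qed.

Lemma star_epic_epi (c b : C) (g : cone c) (f : hom c b) :
  epi f -> star_epic g f = existT (@cone C) b (star g f).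
Proof.
intros Hf; unfold star_epic, im, epic.
generalize (epimorphic_component_epi Hf).
now generalize (epimorphic_component f); intros p ->.
Qed.

Lemma star_epic_id (c : C) (g : cone c) :
  star_epic g (idm c) = existT (@cone C) c g.
Proof.
rewrite star_epic_epi by apply bimorphism_id.
f_equal; apply cone_eq; intros a; apply comp_idr.
Qed.

Lemma star_epic_inclusion (c b d : C) (g : cone c) (f : hom c b) (j : hom b d) :
  inclusion j -> star_epic g (f ;; j) = star_epic g f.
Proof.
intros Hj; unfold star_epic, im, epic.
generalize (epimorphic_component_inclusion f Hj).
now generalize (epimorphic_component f); intros p ->.
Qed.

Lemma cone_mul_star_epic (c b : C) (g : cone c) (f : hom c b) (x : cones C) :
  epi_cone g -> cone_mul (star_epic g f) x = star_epic g (f ;; projT2 x b).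
Proof.
intros Hg; destruct (epicP f) as (j & Hj & He & Ef); unfold cone_mul; simpl.
apply star_epic_eq; trivial.
- now apply epi_cone_star.
- intros a; simpl.
  now rewrite <- (leg_compatible (projT2 x) Hj), <- comp_assoc,
    (comp_assoc (epic f)), (epicE Hj).
Qed.

(** The leg of [h] at im f is the inclusion of im f in the apex of [h], and
    this inclusion turns f° back into f. *)
Lemma cone_mul_comp (c b d : C) (g : cone c) (h : cone b) (f : hom c b)
    (k : hom b d) :
  epi_cone g -> idempotent_cone h ->
  cone_mul (star_epic g f) (star_epic h k) = star_epic g (f ;; k).
Proof.
intros Hg [_ Hh]; rewrite (cone_mul_star_epic _ _ Hg); simpl.
rewrite Hh, comp_idl; destruct (epicP k) as (i & Hi & _).
transitivity (star_epic g ((f ;; epic k) ;; i)).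
- symmetry; now apply star_epic_inclusion.
- now rewrite <- comp_assoc, (epicE Hi).
Qed.

End Factorisation.

(** * The action of a consistent bimorphism on subobjects *)

Lemma mono_factor (C : category) (a b c d : C) (j : hom a b) (u : hom b c)
    (e : hom a d) (i : hom d c) :
  mono j -> mono u -> j ;; u = e ;; i -> mono e.
Proof.
intros Hj Hu E z g h Egh; apply Hj, Hu.
now rewrite <- !comp_assoc, E, !comp_assoc, Egh.
Qed.

Lemma iso_bimorphism (C : category) (a b : C) (f : hom a b) :
  iso f -> bimorphism f.
Proof.
intros (g & E1 & E2); split; intros z h k E.
- now rewrite <- (comp_idr h), <- (comp_idr k), <- E1, !comp_assoc, E.
- now rewrite <- (comp_idl h), <- (comp_idl k), <- E2, <- !comp_assoc, E.
Qed.

Section Bimorphism.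
Context {C : consistent_category} {c d : C} (u : hom c d)
  (bim : bimorphism u).

Let top : core_category c := exist _ c (ex_intro _ (idm c) (inclusion_id c)).

Let core_inclusion_hom (K : consistent_category) (k : K)
    (a b : core_category k) (j : hom (proj1_sig a) (proj1_sig b))
    (Hj : inclusion j) : hom a b :=
  exist _ j (core_inclusion (proj2_sig a) (proj2_sig b) Hj).

Let core_retraction_hom (K : consistent_category) (k : K)
    (a b : core_category k) (q : hom (proj1_sig a) (proj1_sig b))
    (Hq : retraction q) : hom a b :=
  exist _ q (core_retraction (proj2_sig a) (proj2_sig b) Hq).

(** The functor T sends c to an object which is equal to d, but only
    provably so; t and t' are the identity of d seen through this equality. *)
Lemma core_extension :
  exists (T : functor (core_category c) (core_category d))
      (eta : forall a : core_category c, hom (proj1_sig a) (proj1_sig (T a)))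
      (t : hom (proj1_sig (T top)) d) (t' : hom d (proj1_sig (T top))),
    isomorphism_functor T /\
    (forall (a b : core_category c) (j : hom a b),
       inclusion (proj1_sig j) -> inclusion (proj1_sig (fmap T j))) /\
    (forall (a b : core_category c) (h : hom a b),
       proj1_sig h ;; eta b = eta a ;; proj1_sig (fmap T h)) /\
    (forall a, bimorphism (eta a)) /\
    inclusion t /\ inclusion t' /\ eta top ;; t = u.
Proof using bim.
destruct (cc_bimorphism bim) as (T & (isoT & _ & incT & eta & Heta & nat) & _).
exists T, eta.
assert (Et := eq_trans (eq_sym (epimorphic_component_epi (proj2 bim)))
  (eq_trans (f_equal epimorphic_component (eq_sym (comp_idl u)))
    (Heta top (idm c) (inclusion_id c)))).
assert (Ht : exists (t : hom (proj1_sig (T top)) d)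
    (t' : hom d (proj1_sig (T top))),
  inclusion t /\ inclusion t' /\ eta top ;; t = u).
{ revert Et; simpl in *; generalize (eta top); generalize (proj1_sig (T top)).
  intros y e Et; injection Et; intros _ Ey; subst y.
  exists (idm d), (idm d); repeat split; try apply inclusion_id.
  apply inj_pair2 in Et; subst e; apply comp_idr. }
destruct Ht as (t & t' & Ht & Ht' & E).
exists t, t'; do 3 (split; [assumption|]); split; [|now repeat split].
intros [a [j Hj]].
assert (Ea := Heta (exist _ a (ex_intro _ j Hj)) j Hj).
destruct (epimorphic_component_spec Ea) as [He (i & Hi & Ei)].
exact (conj (mono_factor (inclusion_mono Hj) (proj1 bim) Ei) He).
Qed.

(** Applying T to j and p gives i and q, and naturality of the components of T
    at j and p gives the two squares: u carries the idempotent pj of c to the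
    idempotent qi of d, in the sense that pju = uqi. *)
Lemma bimorphism_image (c1 : C) (j : hom c1 c) (p : hom c c1) :
  inclusion j -> j ;; p = idm c1 ->
  exists (d1 : C) (i : hom d1 d) (q : hom d d1) (v : hom c1 d1),
    inclusion i /\ i ;; q = idm d1 /\ bimorphism v /\
    v ;; i = j ;; u /\ p ;; v = u ;; q.
Proof using bim.
intros Hj Hp.
destruct core_extension
  as (T & eta & t & t' & _ & incT & nat & bimT & Ht & Ht' & Et).
set (a := exist _ c1 (ex_intro _ j Hj) : core_category c).
set (hj := @core_inclusion_hom C c a top j Hj).
set (hp := @core_retraction_hom C c top a p
  (ex_intro _ j (conj Hj Hp))).
assert (F : exists (y y1 : C) (et : hom c y) (ea : hom c1 y1) (tj : hom y1 y)
    (tp : hom y y1) (t : hom y d) (t' : hom d y),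
  bimorphism ea /\ inclusion tj /\ tj ;; tp = idm y1 /\
  j ;; et = ea ;; tj /\ p ;; ea = et ;; tp /\
  inclusion t /\ inclusion t' /\ et ;; t = u).
{ exists (proj1_sig (T top)), (proj1_sig (T a)), (eta top), (eta a),
    (proj1_sig (fmap T hj)), (proj1_sig (fmap T hp)), t, t'.
  split; [exact (bimT a)|split; [now apply incT|split]].
  - assert (Ejp : hj ;; hp = idm a) by now apply sig_eq.
    change (proj1_sig (fmap T hj ;; fmap T hp) = proj1_sig (idm (T a))).
    now rewrite <- fmap_comp, Ejp, fmap_id.
  - exact (conj (nat _ _ hj) (conj (nat _ _ hp) (conj Ht (conj Ht' Et)))). }
clear T eta t t' incT nat bimT Ht Ht' Et hj hp.
destruct F as (y & y1 & et & ea & tj & tp & t & t' & bim1 & Htj & Etj & nj &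
  np & Ht & Ht' & Et).
exists y1, (tj ;; t), (t' ;; tp), ea; rewrite <- Et.
split; [now apply inclusion_comp|split; [|split; [assumption|split]]].
- rewrite comp_assoc, <- (comp_assoc tj), (inclusion_section Ht Ht'), comp_idr.
  exact Etj.
- now rewrite !comp_assoc, nj.
- now rewrite <- (comp_assoc et), (comp_assoc t), (inclusion_section Ht Ht'),
    comp_idl.
Qed.

(** Here j exists because T is bijective on objects and p because T is full;
    faithfulness of T then gives j p = 1. *)
Lemma bimorphism_preimage (d1 : C) (i : hom d1 d) (q : hom d d1) :
  inclusion i -> i ;; q = idm d1 ->
  exists (c1 : C) (j : hom c1 c) (p : hom c c1) (v : hom c1 d1),
    inclusion j /\ j ;; p = idm c1 /\ bimorphism v /\
    v ;; i = j ;; u /\ p ;; v = u ;; q.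
Proof using bim.
intros Hi Hq.
destruct core_extension
  as (T & eta & t & t' & [surT ffT] & incT & nat & bimT & Ht & Ht' & Et).
destruct (surT (exist _ d1 (ex_intro _ i Hi))) as (a & Ea & _).
assert (Hs : exists (s : hom (proj1_sig (T a)) d1)
    (s' : hom d1 (proj1_sig (T a))), inclusion s /\ inclusion s').
{ rewrite Ea; exists (idm d1), (idm d1); split; apply inclusion_id. }
clear Ea; destruct Hs as (s & s' & Hs & Hs').
assert (F : exists (y y1 : C) (et : hom c y) (tp : hom y y1) (t : hom y d)
    (t' : hom d y) (s : hom y1 d1) (s' : hom d1 y1),
  inclusion t /\ inclusion t' /\ inclusion s /\ inclusion s' /\ et ;; t = u /\
  tp = t ;; q ;; s' /\
  exists (c1 : C) (j : hom c1 c) (p : hom c c1) (ea : hom c1 y1),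
    inclusion j /\ j ;; p = idm c1 /\ bimorphism ea /\
    j ;; et = ea ;; (s ;; i ;; t') /\ p ;; ea = et ;; tp).
{ destruct (proj2_sig a) as [j Hj].
  set (hj := @core_inclusion_hom C c a top j Hj).
  assert (Esi : s ;; i ;; t' ;; (t ;; q ;; s') = idm _).
  { rewrite !comp_assoc, <- (comp_assoc (s ;; i)), (inclusion_section Ht' Ht).
    rewrite comp_idr, <- (comp_assoc s), Hq, comp_idr.
    exact (inclusion_section Hs Hs'). }
  assert (Hr : retraction (t ;; q ;; s')).
  { exists (s ;; i ;; t'); auto using inclusion_comp. }
  destruct (ffT top a (@core_retraction_hom C d (T top) (T a) _ Hr))
    as (hp & Ep & _).
  apply (f_equal (@proj1_sig _ _)) in Ep; simpl in Ep.
  assert (Ej : proj1_sig (fmap T hj) = s ;; i ;; t').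
  { apply inclusion_thin; [now apply incT|auto using inclusion_comp]. }
  exists (proj1_sig (T top)), (proj1_sig (T a)), (eta top),
    (proj1_sig (fmap T hp)), t, t', s, s'.
  do 5 (split; [assumption|]); split; [exact Ep|].
  exists (proj1_sig a), j, (proj1_sig hp), (eta a).
  split; [assumption|split; [|split; [exact (bimT a)|split]]].
  - assert (E : hj ;; hp = idm a).
    { destruct (ffT a a (idm (T a))) as (x & _ & Hx).
      transitivity x; [symmetry|]; apply Hx; [|apply fmap_id].
      rewrite fmap_comp; apply sig_eq; simpl in *.
      now rewrite Ep, Ej. }
    exact (f_equal (@proj1_sig _ _) E).
  - rewrite <- Ej; exact (nat _ _ hj).
  - exact (nat _ _ hp). }
clear T a eta t t' s s' incT surT ffT nat bimT Ht Ht' Et Hs Hs'.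
destruct F as (y & y1 & et & tp & t & t' & s & s' & Ht & Ht' & Hs & Hs' & Et &
  Ep & c1 & j & p & ea & Hj & Hp & bim1 & nj & np).
exists c1, j, p, (ea ;; s).
split; [assumption|split; [assumption|split; [|split]]].
- apply bimorphism_comp, iso_bimorphism; trivial.
  exists s'; split; now apply inclusion_section.
- rewrite <- Et, comp_assoc, nj.
  now rewrite <- !comp_assoc, (inclusion_section Ht' Ht), comp_idr.
- rewrite comp_assoc, np, Ep, <- Et.
  now rewrite <- !comp_assoc, (inclusion_section Hs' Hs), comp_idr.
Qed.

End Bimorphism.

(** * Functors into the consistent dual *)

Section HFunctors.
Context {L : consistent_category}.

Lemma idempotent_leg (c : L) (e : cone c) (a : L) (j : hom a c) :
  idempotent_cone e -> inclusion j -> e a = j.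
Proof.
intros [_ He] Hj; rewrite <- (leg_compatible e Hj), He; apply comp_idr.
Qed.

(** Equality of the sets forces equality of the maps between them: if
    e * f° = e' * f'° then e(a)f = e'(a)f' for all a, so that
    e * (fg)° = e' * (f'g)°. *)
Lemma H_functor_eq (c c' : L) (e : cone c) (e' : cone c')
    (idem : idempotent_cone e) (idem' : idempotent_cone e') :
  (forall b x, @H_set L c e b x <-> @H_set L c' e' b x) ->
  H_functor idem = H_functor idem'.
Proof.
intros E.
assert (nat : forall (k k' : L) (f : cone k) (f' : cone k')
  (If : idempotent_cone f) (If' : idempotent_cone f')
  (sub : forall b x, @H_set L k f b x -> @H_set L k' f' b x)
  (a b : L) (g : hom a b) (x : {x | @H_set L k f a x}),
  proj1_sig (H_map g x) =
  proj1_sig (H_map g (exist _ (proj1_sig x) (sub a _ (proj2_sig x)) :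
    {x | @H_set L k' f' a x}))).
{ intros k k' f f' If If' sub a b g [x Hx].
  pose proof Hx as [h Eh]; destruct (sub _ _ Hx) as [h' Eh'].
  refine (eq_trans (@H_mapE L k f If a b g (exist _ x Hx) h Eh) (eq_sym
    (eq_trans (@H_mapE L k' f' If' a b g (exist _ x (sub a x Hx)) h' Eh') _))).
  symmetry.
  apply star_epic_eq; try now apply idempotent_epi_cone.
  intros z; rewrite !comp_assoc; f_equal.
  apply star_epic_legs; congruence. }
assert (trans : forall (k k' : L) (f : cone k) (f' : cone k')
  (If : idempotent_cone f) (If' : idempotent_cone f'),
  (forall b x, @H_set L k f b x -> @H_set L k' f' b x) ->
  exists s : nat_trans (H_functor If) (H_functor If'),
    forall a x, proj1_sig (s a x) = proj1_sig x).
{ intros k k' f f' If If' sub.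
  unshelve eexists (@NatTrans _ _ (H_functor If) (H_functor If')
    (fun a x => exist _ (proj1_sig x) (sub a _ (proj2_sig x))) _);
    [|reflexivity].
  intros a b g; apply functional_extensionality; intros x; apply sig_eq.
  exact (nat _ _ _ _ If If' sub a b g x). }
destruct (trans _ _ _ _ idem idem' (fun b x => proj1 (E b x))) as [s Hs].
destruct (trans _ _ _ _ idem' idem (fun b x => proj2 (E b x))) as [t Ht].
exact (functor_subsets_eq Hs Ht).
Qed.

Lemma H_functor_cone_eq (c c' : L) (e : cone c) (e' : cone c')
    (idem : idempotent_cone e) (idem' : idempotent_cone e') :
  existT (@cone L) c e = existT (@cone L) c' e' ->
  H_functor idem = H_functor idem'.
Proof.
intros E; injection E; intros _ Ec; subst c'.
apply inj_pair2 in E; subst e'; now rewrite (proof_irrelevance _ idem idem').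
Qed.

(** Composing [e] with the inverse of its leg at [c] moves the apex to [c] and
    keeps the functor. *)
Lemma H_functor_move (c a : L) (e : cone a) (idem : idempotent_cone e) :
  iso (e c) ->
  exists (e' : cone c) (idem' : idempotent_cone e'),
    H_functor idem' = H_functor idem.
Proof.
intros (g & E1 & E2).
assert (idem' : idempotent_cone (star e g)).
{ split; [|exact E1]; exists c; simpl; rewrite E1; apply bimorphism_id. }
exists (star e g), idem'; apply H_functor_eq; intros b x.
split; intros [f ->].
- exists (g ;; f); apply star_epic_eq; try now apply idempotent_epi_cone.
  intros z; simpl; now rewrite comp_assoc.
- exists (e c ;; f); apply star_epic_eq; try now apply idempotent_epi_cone.
  intros z; simpl; now rewrite comp_assoc, <- (comp_assoc (e z)), E2, comp_idr.
Qed.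

End HFunctors.

Lemma local_inclusion (K L : category_with_subobjects) (F : functor K L) :
  local_isomorphism F -> inclusion_preserving F.
Proof. now intros [incF _]. Qed.

Lemma functor_category_comp (C D : category) (P Q R : functor_category C D)
    (s : hom P Q) (t : hom Q R) (b : C) :
  component (s ;; t) b = component s b ;; component t b.
Proof. reflexivity. Qed.

Lemma dual_comp (L : consistent_category) (P Q R : dual L) (s : hom P Q)
    (t : hom Q R) (b : L) (x : {x | proj1_sig P b x}) :
  component (s ;; t) b x = component t b (component s b x).
Proof.
exact (f_equal (fun h => h x) (@functor_category_comp L (subsets (cones L))
  (proj1_sig P) (proj1_sig Q) (proj1_sig R) s t b)).
Qed.

Section LocalIsomorphisms.
Context {K L : consistent_category} (F : functor K (dual L))
  (locF : local_isomorphism F).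

(** The generic form of both gamma(c,d) and delta(c,d). *)
Definition apex_cone (c : L) (d : K) : cone c :=
  epsilon (inhabited_cone c) (fun e =>
    exists idem : idempotent_cone e, H_functor idem = proj1_sig (F d)).

Lemma apex_coneP (c : L) (d : K) :
  M_set (F d) c ->
  exists idem : idempotent_cone (apex_cone c d),
    H_functor idem = proj1_sig (F d).
Proof.
intros (a & e & idem & E & Hi).
destruct (H_functor_move idem Hi) as (e' & idem' & E').
apply (epsilon_spec (inhabited_cone c) (fun e => exists idem : idempotent_cone e,
  H_functor idem = proj1_sig (F d))).
exists e', idem'; congruence.
Qed.

Lemma M_set_inhabited (d : K) : exists c, M_set (F d) c.
Proof.
destruct (proj2_sig (F d)) as (c & e & idem & E).
exists c, c, e, idem; split; trivial.
rewrite (proj2 idem); exists (idm c); split; apply comp_idl.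
Qed.

Lemma dual_mem (c : L) (d : K) :
  M_set (F d) c -> forall b (x : cones L),
  proj1_sig (F d) b x <-> exists f : hom c b, x = star_epic (apex_cone c d) f.
Proof. intros H; destruct (apex_coneP H) as [idem <-]; reflexivity. Qed.

Lemma dual_map (c : L) (d : K) :
  M_set (F d) c -> forall a b (g : hom a b) (x : {x | proj1_sig (F d) a x})
    (f : hom c a),
  proj1_sig x = star_epic (apex_cone c d) f ->
  proj1_sig (fmap (proj1_sig (F d)) g x) = star_epic (apex_cone c d) (f ;; g).
Proof.
intros H; destruct (apex_coneP H) as [idem <-]; intros a b g x f E.
exact (H_mapE idem g E).
Qed.

Lemma apex_cone_idem (c : L) (d : K) :
  M_set (F d) c -> idempotent_cone (apex_cone c d).
Proof. now intros H; destruct (apex_coneP H). Qed.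

(** By inclusion preservation the cone of d1 is an element e * k° of F(d), where
    e is the cone of d; evaluating at the apex c of e identifies k. *)
Lemma apex_cone_sub (c c1 : L) (d d1 : K) :
  M_set (F d) c -> M_set (F d1) c1 -> subobject d1 d ->
  forall a, apex_cone c1 d1 a = apex_cone c d a ;; apex_cone c1 d1 c.
Proof.
intros H H1 [j Hj]; destruct locF as (incF & _).
assert (x : proj1_sig (F d1) c1 (star_epic (apex_cone c1 d1) (idm c1))).
{ apply (dual_mem H1); eauto. }
assert (x' : proj1_sig (F d) c1 (star_epic (apex_cone c1 d1) (idm c1))).
{ exact (eq_ind _ (proj1_sig (F d) c1)
    (proj2_sig (component (fmap F j) c1 (exist _ _ x))) _
    (incF _ _ j Hj c1 (exist _ _ x))). }
apply (dual_mem H) in x'; destruct x' as [k Ek].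
assert (Ea := star_epic_legs Ek).
assert (Ek' : apex_cone c1 d1 c = k).
{ rewrite <- (comp_idr (apex_cone c1 d1 c)), Ea.
  rewrite (proj2 (apex_cone_idem H)); apply comp_idl. }
intros a; now rewrite Ek', <- Ea, comp_idr.
Qed.

Lemma ideal_inj (d d1 d2 : K) :
  subobject d1 d -> subobject d2 d ->
  proj1_sig (F d1) = proj1_sig (F d2) -> d1 = d2.
Proof.
intros H1 H2 E; destruct locF as (incF & _ & isoF).
destruct (isoF d) as [bij _].
set (x1 := exist _ d1 H1 : ideal d); set (x2 := exist _ d2 H2 : ideal d).
destruct (bij (restrict_ideal incF d x1)) as (x & _ & Hx).
assert (E1 := Hx x1 eq_refl).
assert (E2 : x = x2).
{ apply Hx; apply sig_eq, sig_eq; simpl; now symmetry. }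
exact (f_equal (@proj1_sig _ _) (eq_trans (eq_sym E1) E2)).
Qed.

(** The generic form of the transpose; for F = Delta it is the relation
    [is_transpose]. *)
Definition transpose_of (k' k : K) (c c' : L) (f : hom k' k) (g : hom c' c) :
    Prop :=
  forall (b : L) (h : hom c b) (x : {x | proj1_sig (F k') b x}),
    proj1_sig x = star_epic (apex_cone c k') h ->
    proj1_sig (component (fmap F f) b x) = star_epic (apex_cone c' k) (g ;; h).

Lemma apex_cone_mem (c : L) (d : K) (b : L) (f : hom c b) :
  M_set (F d) c -> proj1_sig (F d) b (star_epic (apex_cone c d) f).
Proof. intros H; apply (dual_mem H); eauto. Qed.

(** Yoneda: g is read off from the image of the cone of k' itself, which is the
    element of F(k')(c) corresponding to the identity of c. *)
Lemma transpose_exists (k' k : K) (c c' : L) (f : hom k' k) :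
  M_set (F k') c -> M_set (F k) c' -> exists g : hom c' c, transpose_of f g.
Proof.
intros H H'.
set (x0 := exist _ _ (apex_cone_mem (idm c) H) : {x | proj1_sig (F k') c x}).
destruct (proj1 (dual_mem H' _ _) (proj2_sig (component (fmap F f) c x0)))
  as [g Eg].
exists g; intros b h x Ex.
assert (E0 : fmap (proj1_sig (F k')) h x0 = x).
{ apply sig_eq; rewrite Ex.
  refine (eq_trans (dual_map H h (x := x0) (f := idm c) eq_refl) _).
  now rewrite comp_idl. }
rewrite <- E0.
assert (nat := f_equal (fun k => proj1_sig (k x0))
  (naturality (fmap F f : nat_trans _ _) h)).
exact (eq_trans nat (dual_map H' h Eg)).
Qed.

Lemma transpose_unique (k' k : K) (c c' : L) (f : hom k' k) (g g' : hom c' c) :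
  M_set (F k') c -> M_set (F k) c' ->
  transpose_of f g -> transpose_of f g' -> g = g'.
Proof.
intros H H' Hg Hg'; apply (star_epic_inj (apex_cone_idem H')).
rewrite <- (comp_idr g), <- (comp_idr g').
set (x0 := exist _ _ (apex_cone_mem (idm c) H) : {x | proj1_sig (F k') c x}).
now rewrite <- (Hg c (idm c) x0), <- (Hg' c (idm c) x0).
Qed.

Lemma transpose_id (k : K) (c : L) : transpose_of (idm k) (idm c).
Proof.
intros b h x Ex; rewrite fmap_id, comp_idl; exact Ex.
Qed.

Lemma transpose_comp (k1 k2 k3 : K) (c1 c2 c3 : L) (f : hom k1 k2)
    (f' : hom k2 k3) (g : hom c2 c1) (g' : hom c3 c2) :
  transpose_of f g -> transpose_of f' g' -> transpose_of (f ;; f') (g' ;; g).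
Proof.
intros Hg Hg' b h x Ex; rewrite fmap_comp, <- comp_assoc.
rewrite dual_comp.
exact (Hg' b (g ;; h) (component (fmap F f) b x) (Hg b h x Ex)).
Qed.

Lemma transpose_faithful (k' k : K) (c c' : L) (f f' : hom k' k)
    (g : hom c' c) :
  M_set (F k') c -> transpose_of f g -> transpose_of f' g -> f = f'.
Proof.
intros H Hf Hf'; destruct locF as (_ & ff & _).
destruct (ff _ _ (fmap F f)) as (h & _ & Hh).
transitivity h; [symmetry|]; apply Hh; trivial.
apply nat_trans_eq; intros b; apply functional_extensionality; intros x.
apply sig_eq; destruct (proj1 (dual_mem H _ _) (proj2_sig x)) as [m Em].
exact (eq_trans (Hf' _ _ _ Em) (eq_sym (Hf _ _ _ Em))).
Qed.

Lemma transpose_full (k' k : K) (c c' : L) (g : hom c' c) :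
  M_set (F k') c -> M_set (F k) c' -> exists f : hom k' k, transpose_of f g.
Proof.
intros H H'; destruct locF as (_ & ff & _).
set (rep := fun b (x : {x | proj1_sig (F k') b x}) =>
  constructive_indefinite_description _
    (proj1 (dual_mem H _ _) (proj2_sig x))).
set (s := fun b (x : {x | proj1_sig (F k') b x}) =>
  exist (proj1_sig (F k) b) _
    (apex_cone_mem (g ;; proj1_sig (rep b x)) H')).
assert (Hs : forall (b : L) (h : hom c b) (x : {x | proj1_sig (F k') b x}),
  proj1_sig x = star_epic (apex_cone c k') h ->
  proj1_sig (s b x) = star_epic (apex_cone c' k) (g ;; h)).
{ intros b h x Ex; unfold s; simpl; destruct (rep b x) as [h' E']; simpl.
  now rewrite (star_epic_inj (apex_cone_idem H) (eq_trans (eq_sym Ex) E')). }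
assert (nat : forall (a b : L) (h : hom a b),
  fmap (proj1_sig (F k')) h ;; (s b : hom (_ : subsets _) _) =
  (s a : hom (_ : subsets _) _) ;; fmap (proj1_sig (F k)) h).
{ intros a b h; apply functional_extensionality; intros x; apply sig_eq.
  destruct (proj1 (dual_mem H _ _) (proj2_sig x)) as [m Em].
  refine (eq_trans (Hs _ _ _ (dual_map H h Em)) (eq_sym _)).
  refine (eq_trans (dual_map H' h (Hs _ _ _ Em)) _).
  now rewrite comp_assoc. }
destruct (ff k' k (NatTrans nat : hom (F k') (F k))) as (f & Ef & _).
exists f; intros b h x Ex; rewrite Ef; exact (Hs b h x Ex).
Qed.

(** Contravariance of the transpose turns left cancellation into right
    cancellation: as every object of L is an apex for some F(k0), the two
    morphisms to be identified are transposes as well. *)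
Lemma transpose_epi (k' k : K) (c c' : L) (f : hom k' k) (g : hom c' c) :
  M_set (F k') c -> M_set (F k) c' -> transpose_of f g ->
  (forall z : L, exists k0, M_set (F k0) z) -> mono f -> epi g.
Proof.
intros H H' Hg sur Hf z a b E; destruct (sur z) as [k0 H0].
destruct (transpose_full a H0 H) as [a' Ha].
destruct (transpose_full b H0 H) as [b' Hb].
assert (E' : a' = b').
{ apply Hf, (transpose_faithful H0 (transpose_comp Ha Hg)).
  rewrite E; exact (transpose_comp Hb Hg). }
subst b'; exact (transpose_unique H0 H Ha Hb).
Qed.

(** F(j) is the inclusion of F(k') in F(k), and the cone of k' is obtained from
    the cone of k by composing with its leg at the apex c'. *)
Lemma transpose_inclusion (k' k : K) (c c' : L) (j : hom k' k) :
  M_set (F k') c -> M_set (F k) c' -> inclusion j ->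
  transpose_of j (apex_cone c k' c').
Proof.
intros H H' Hj b h x Ex.
refine (eq_trans (local_inclusion locF Hj b x) (eq_trans Ex _)).
apply star_epic_eq; try now apply idempotent_epi_cone, apex_cone_idem.
intros a; rewrite comp_assoc; f_equal.
now apply apex_cone_sub; [| |exists j].
Qed.

End LocalIsomorphisms.

(** * Linked pairs as morphisms between idempotents *)

Section LinkedPairs.
Context {Om : cross_connection}.
Notation C := (xcC Om).
Notation D := (xcD Om).
Notation E := (E_set Om).
Notation i := (@E_idempotent Om).
Notation mul := (@linked_mul Om).

Lemma E_M (e : E) : M_set (Gamma Om (Ed e)) (Ec e).
Proof. exact (proj2_sig e). Qed.

Lemma E_M' (e : E) : M_set (Delta Om (Ec e)) (Ed e).
Proof. apply Gamma_Delta, E_M. Qed.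

Lemma E_gamma_idem (e : E) : idempotent_cone (E_gamma e).
Proof. exact (apex_cone_idem (E_M e)). Qed.

Lemma E_delta_idem (e : E) : idempotent_cone (E_delta e).
Proof. exact (apex_cone_idem (E_M' e)). Qed.

Lemma E_gamma_epi (e : E) : epi_cone (E_gamma e).
Proof. apply idempotent_epi_cone, E_gamma_idem. Qed.

Lemma E_delta_epi (e : E) : epi_cone (E_delta e).
Proof. apply idempotent_epi_cone, E_delta_idem. Qed.

Lemma E_gamma_sub (e f : E) :
  subobject (Ed e) (Ed f) ->
  forall a, E_gamma e a = E_gamma f a ;; E_gamma e (Ec f).
Proof. exact (apex_cone_sub (Gamma_local Om) (E_M f) (E_M e)). Qed.

Lemma E_delta_sub (e f : E) :
  subobject (Ec e) (Ec f) ->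
  forall a, E_delta e a = E_delta f a ;; E_delta e (Ed f).
Proof. exact (apex_cone_sub (Delta_local Om) (E_M' f) (E_M' e)). Qed.

Definition transpose (e f : E) (h : hom (Ec e) (Ec f)) : hom (Ed f) (Ed e) :=
  proj1_sig (constructive_indefinite_description _
    (transpose_exists h (E_M' e) (E_M' f))).

Lemma transposeP (e f : E) (h : hom (Ec e) (Ec f)) :
  transpose_of (Delta Om) h (transpose h).
Proof. exact (proj2_sig (constructive_indefinite_description _ _)). Qed.

Lemma transposeE (e f : E) (h : hom (Ec e) (Ec f)) (g : hom (Ed f) (Ed e)) :
  transpose_of (Delta Om) h g -> transpose h = g.
Proof. exact (transpose_unique (E_M' e) (E_M' f) (transposeP h)). Qed.

Lemma transpose_mul (e f g : E) (h : hom (Ec e) (Ec f)) (k : hom (Ec f) (Ec g)) :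
  transpose (h ;; k) = transpose k ;; transpose h.
Proof. apply transposeE, transpose_comp; apply transposeP. Qed.

Lemma transpose_1 (e : E) : transpose (idm (Ec e)) = idm (Ed e).
Proof. apply transposeE, transpose_id. Qed.

(** Between the idempotents e and f these pairs lie in the local set eSf of the
    semigroup S of linked pairs. *)
Definition pair_of (e f : E) (h : hom (Ec e) (Ec f)) : cones C * cones D :=
  (star_epic (E_gamma e) h, star_epic (E_delta f) (transpose h)).

Lemma pair_of_linked (e f : E) (h : hom (Ec e) (Ec f)) : linked (pair_of h).
Proof.
exists (Ec f), (Ed e), (Ec e), (Ed f), h, (transpose h).
split; [apply E_M|split; [apply E_M'|split; [exact (transposeP h)|now split]]].
Qed.

Lemma pair_of_id (e : E) : pair_of (idm (Ec e)) = i e.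
Proof. unfold pair_of; now rewrite transpose_1, !star_epic_id. Qed.

Lemma pair_of_mul (e f g : E) (h : hom (Ec e) (Ec f)) (k : hom (Ec f) (Ec g)) :
  mul (pair_of h) (pair_of k) = pair_of (h ;; k).
Proof.
unfold pair_of, linked_mul; simpl; rewrite transpose_mul.
now rewrite !cone_mul_comp by auto using E_gamma_epi, E_delta_epi,
  E_gamma_idem, E_delta_idem.
Qed.

Lemma pair_of_inj (e f : E) (h k : hom (Ec e) (Ec f)) :
  pair_of h = pair_of k -> h = k.
Proof.
intros H; exact (star_epic_inj (E_gamma_idem e) (f_equal fst H)).
Qed.

Lemma pair_of_idl (e f : E) (h : hom (Ec e) (Ec f)) :
  mul (i e) (pair_of h) = pair_of h.
Proof. now rewrite <- pair_of_id, pair_of_mul, comp_idl. Qed.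

Lemma pair_of_idr (e f : E) (h : hom (Ec e) (Ec f)) :
  mul (pair_of h) (i f) = pair_of h.
Proof. now rewrite <- pair_of_id, pair_of_mul, comp_idr. Qed.

Lemma E_mul (e f : E) :
  mul (i e) (i f) =
  (star_epic (E_gamma e) (E_gamma f (Ec e)),
   star_epic (E_delta f) (E_delta e (Ed f))).
Proof. reflexivity. Qed.

Lemma omega_l_sub (e f : E) :
  omega_l mul i e f <-> subobject (Ec e) (Ec f).
Proof.
unfold omega_l; rewrite E_mul; split.
- intros H; apply (f_equal (fun p => projT1 (fst p))) in H; simpl in H.
  destruct (epicP (E_gamma f (Ec e))) as (j & Hj & _); revert j Hj.
  rewrite H; intros j Hj; now exists j.
- intros [j Hj]; unfold E_idempotent; rewrite <- !star_epic_id; f_equal.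
  + rewrite (idempotent_leg (E_gamma_idem f) Hj), <- (comp_idl j).
    now apply star_epic_inclusion.
  + apply star_epic_eq; try apply E_delta_epi.
    intros a; rewrite comp_idr; symmetry; apply E_delta_sub; now exists j.
Qed.

Lemma omega_r_sub (e f : E) :
  omega_r mul i e f <-> subobject (Ed e) (Ed f).
Proof.
unfold omega_r; rewrite E_mul; split.
- intros H; apply (f_equal (fun p => projT1 (snd p))) in H; simpl in H.
  destruct (epicP (E_delta f (Ed e))) as (j & Hj & _); revert j Hj.
  rewrite H; intros j Hj; now exists j.
- intros [j Hj]; unfold E_idempotent; rewrite <- !star_epic_id; f_equal.
  + apply star_epic_eq; try apply E_gamma_epi.
    intros a; rewrite comp_idr; symmetry; apply E_gamma_sub; now exists j.
  + rewrite (idempotent_leg (E_delta_idem f) Hj), <- (comp_idl j).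
    now apply star_epic_inclusion.
Qed.

Lemma omega_sub (e f : E) : omega mul i e f <-> E_sub e f.
Proof. unfold omega, E_sub; now rewrite omega_l_sub, omega_r_sub. Qed.

End LinkedPairs.

(** * Inductive cancellative categories from semigroups *)

Section PartialSemigroup.
Context {U : Type} {op : U -> U -> U} {S : U -> Prop} (sg : is_semigroup op S).
Infix "*" := op.

Lemma sg_closed x y : S x -> S y -> S (x * y).
Proof. apply sg. Qed.

Lemma sg_assoc x y z : S x -> S y -> S z -> x * (y * z) = (x * y) * z.
Proof. apply sg. Qed.

Lemma sg_extend a b c z :
  a * b = c -> S a -> S b -> S z -> (z * a) * b = z * c.
Proof. intros <- Ha Hb Hz; now rewrite sg_assoc. Qed.

Context {V : Type} {i : V -> U} (biordered : regular_biordered_set op i S).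

Lemma biordered_in e : S (i e).
Proof using biordered. now apply biordered; exists e. Qed.

Lemma biordered_idem e : i e * i e = i e.
Proof using biordered. now apply biordered; exists e. Qed.

Lemma biordered_inj e f : i e = i f -> e = f.
Proof using biordered. apply biordered. Qed.

Lemma biordered_ex x : S x -> x * x = x -> exists e, i e = x.
Proof using biordered. now intros H1 H2; apply biordered. Qed.

End PartialSemigroup.

(* The operation is associative only on S, so that rebracketing has membership
   side conditions.  Products are kept bracketed to the left; [sg_use H] applies
   the equation [H : a * b = c] to two consecutive factors of such a product. *)
Ltac sg_mem := eauto 8 with sg.
Ltac sg_norm sg := repeat rewrite (sg_assoc sg) by sg_mem.
Ltac sg_use sg H :=
  progress (repeat (first [rewrite H | rewrite (sg_extend sg H) by sg_mem];
    sg_norm sg)).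

(** The setting abstracts from linked pairs: the morphisms of [I] from e to f
    are represented faithfully by elements of eSf which can be cancelled on the
    subsemigroups generated by the idempotents below e and below f, and both the
    order and the distinguished morphisms are described by equations in S. *)
Section SemigroupCategory.
Context {U : Type} {op : U -> U -> U} {S : U -> Prop} {I : category} {i : I -> U}
  {le : relation (arrow I)} {dist : forall e f : I, hom e f -> Prop}
  {X : forall e f : I, hom e f -> U}.
Infix "*" := op.
Notation core e := (core_semigroup op S (i e)).
Hypothesis biordered : regular_biordered_set op i S.
Hypothesis all_bimorphisms : forall (e f : I) (u : hom e f), bimorphism u.
Hypothesis X_in : forall (e f : I) (u : hom e f), S (X u).
Hypothesis X_id : forall e : I, X (idm e) = i e.
Hypothesis X_comp : forall (e f g : I) (u : hom e f) (v : hom f g),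
  X (u ;; v) = X u * X v.
Hypothesis X_inj : forall (e f : I) (u v : hom e f), X u = X v -> u = v.
Hypothesis cancel_l : forall (e f : I) (u : hom e f) s t,
  core f s -> core f t -> X u * s = X u * t -> s = t.
Hypothesis cancel_r : forall (e f : I) (u : hom e f) s t,
  core e s -> core e t -> s * X u = t * X u -> s = t.
Hypothesis leE : forall (e1 f1 e f : I) (u : hom e1 f1) (v : hom e f),
  le (Arrow u) (Arrow v) <->
  omega op i e1 e /\ omega op i f1 f /\ X u = i e1 * X v /\ X u = X v * i f1.
Hypothesis restriction : forall (e f e1 : I) (u : hom e f),
  omega op i e1 e -> exists (f1 : I) (v : hom e1 f1), le (Arrow v) (Arrow u).
Hypothesis corestriction : forall (e f f1 : I) (u : hom e f),
  omega op i f1 f -> exists (e1 : I) (v : hom e1 f1), le (Arrow v) (Arrow u).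
Hypothesis distE : forall (e f : I) (m : hom e f),
  dist m <-> (R_rel op i e f \/ L_rel op i e f) /\ X m = i e * i f.
Hypothesis dist_hom : forall e f : I,
  R_rel op i e f \/ L_rel op i e f -> exists m : hom e f, X m = i e * i f.

Let sg : is_semigroup op S := proj1 biordered.

Let i_in := biordered_in biordered.
Let i_idem := biordered_idem biordered.
Let i_inj := biordered_inj biordered.
Let i_surj := biordered_ex biordered.

Lemma S_mul x y : S x -> S y -> S (x * y).
Proof using biordered. apply (sg_closed sg). Qed.

Hint Resolve i_in X_in S_mul : sg.
Ltac norm := sg_norm sg.
Ltac use H := sg_use sg H.

Lemma core_omega e e1 : omega op i e1 e -> core e (i e1).
Proof using biordered.
intros [H1 H2]; apply generated_in; repeat split; auto using i_in, i_idem.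
Qed.

Lemma omega_antisym e f : omega op i e f -> omega op i f e -> e = f.
Proof using biordered.
intros [H1 _] [_ H2]; apply i_inj; unfold omega_l, omega_r in *; congruence.
Qed.

Lemma omega_refl e : omega op i e e.
Proof using biordered. split; apply i_idem. Qed.

Lemma omega_trans e f g : omega op i e f -> omega op i f g -> omega op i e g.
Proof using biordered.
unfold omega, omega_l, omega_r; intros [H1 H2] [H3 H4]; split.
- rewrite <- H1 at 1; rewrite <- (sg_assoc sg) by sg_mem; now rewrite H3.
- rewrite <- H2 at 1; norm; now rewrite H4.
Qed.

Lemma X_idl (e f : I) (u : hom e f) : i e * X u = X u.
Proof using X_comp X_id. now rewrite <- X_id, <- X_comp, comp_idl. Qed.

Lemma X_idr (e f : I) (u : hom e f) : X u * i f = X u.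
Proof using X_comp X_id. now rewrite <- X_id, <- X_comp, comp_idr. Qed.

Lemma le_id e f : omega op i e f <-> le (Arrow (idm e)) (Arrow (idm f)).
Proof using biordered leE X_id.
rewrite leE, !X_id; split; [|tauto]; intros H; repeat split; try apply H.
- symmetry; apply H.
- symmetry; apply H.
Qed.

Lemma arrow_eq (e f : I) (e' f' : I) (u : hom e f) (v : hom e' f') :
  e = e' -> f = f' -> X u = X v -> Arrow u = Arrow v.
Proof using X_inj. intros <- <- E; now rewrite (X_inj E). Qed.

Lemma le_order : order (arrow I) le.
Proof using biordered leE X_id X_comp X_inj X_in.
split.
- intros [e f u]; rewrite leE, X_idl, X_idr; auto using omega_refl.
- intros [e1 f1 u1] [e2 f2 u2] [e3 f3 u3]; rewrite !leE.
  intros (A1 & B1 & C1 & D1) (A2 & B2 & C2 & D2).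
  split; [eapply omega_trans; eassumption|].
  split; [eapply omega_trans; eassumption|].
  split; [rewrite C1, C2|rewrite D1, D2]; norm.
  + now rewrite (proj1 A1).
  + rewrite <- (sg_assoc sg) by sg_mem; now rewrite (proj2 B1).
- intros [e1 f1 u1] [e2 f2 u2]; rewrite !leE.
  intros (A1 & B1 & C1 & D1) (A2 & B2 & C2 & D2).
  assert (e1 = e2) by now apply omega_antisym.
  assert (f1 = f2) by now apply omega_antisym.
  subst e2 f2; apply arrow_eq; trivial; rewrite C1; apply X_idl.
Qed.

(** The domain e1 and codomain f1 of a restriction of [x] are related by
    e1 x = x f1.  The relation s x = x t, for s and t generated by the
    idempotents below the domain and below the codomain of [x], is compatible
    with products and by cancellation one-to-one, so that it transfers equations
    between elements s to equations between elements t and back. *)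
Lemma transfer_le (e f e1 f1 : I) (x : hom e f) (x1 : hom e1 f1) :
  le (Arrow x1) (Arrow x) ->
  core e (i e1) /\ core f (i f1) /\ i e1 * X x = X x * i f1.
Proof using biordered leE.
rewrite leE; intros (A & B & H1 & H2); split; [|split]; auto using core_omega.
congruence.
Qed.

Lemma core_in e s : core e s -> S s.
Proof using biordered.
unfold core_semigroup; induction 1 as [x [[H _] _]|]; trivial.
now apply (sg_closed sg).
Qed.

Hint Resolve core_in : sg.

Lemma transfer_mul (e f : I) (x : hom e f) s s' t t' :
  S s -> S s' -> S t -> S t' -> s * X x = X x * t -> s' * X x = X x * t' ->
  (s * s') * X x = X x * (t * t').
Proof using biordered X_in.
intros Hs Hs' Ht Ht' E E'.
rewrite <- (sg_assoc sg) by sg_mem; rewrite E'; norm; now rewrite E.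
Qed.

Lemma transfer_iff (e f : I) (x : hom e f) s s' t t' :
  core e s -> core e s' -> core f t -> core f t' ->
  s * X x = X x * t -> s' * X x = X x * t' -> s = s' <-> t = t'.
Proof using cancel_l cancel_r.
intros Hs Hs' Ht Ht' E E'; split; intros <-.
- apply (cancel_l (u := x)); congruence.
- apply (cancel_r (u := x)); congruence.
Qed.

Lemma omega_r_transfer (a b e1 f1 e2 f2 : I) (x : hom a b) (x1 : hom e1 f1)
    (x2 : hom e2 f2) :
  le (Arrow x1) (Arrow x) -> le (Arrow x2) (Arrow x) ->
  omega_r op i e1 e2 <-> omega_r op i f1 f2.
Proof using biordered leE X_in cancel_l cancel_r.
intros H1 H2; apply transfer_le in H1, H2.
destruct H1 as (A1 & B1 & E1), H2 as (A2 & B2 & E2).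
apply (@transfer_iff a b x); trivial; try now apply generated_op.
apply transfer_mul; sg_mem.
Qed.

Lemma omega_l_transfer (a b e1 f1 e2 f2 : I) (x : hom a b) (x1 : hom e1 f1)
    (x2 : hom e2 f2) :
  le (Arrow x1) (Arrow x) -> le (Arrow x2) (Arrow x) ->
  omega_l op i e1 e2 <-> omega_l op i f1 f2.
Proof using biordered leE X_in cancel_l cancel_r.
intros H1 H2; apply transfer_le in H1, H2.
destruct H1 as (A1 & B1 & E1), H2 as (A2 & B2 & E2).
apply (@transfer_iff a b x); trivial; try now apply generated_op.
apply transfer_mul; sg_mem.
Qed.

Lemma le_unique_cod (e f e1 f1 f1' : I) (x : hom e f) (x1 : hom e1 f1)
    (x1' : hom e1 f1') :
  le (Arrow x1) (Arrow x) -> le (Arrow x1') (Arrow x) -> f1 = f1'.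
Proof using biordered leE cancel_l cancel_r.
intros H H'; apply transfer_le in H, H'.
destruct H as (A & B & E), H' as (A' & B' & E').
now apply i_inj, (@transfer_iff _ _ x _ _ _ _ A A' B B' E E').
Qed.

Lemma le_unique_dom (e f e1 e1' f1 : I) (x : hom e f) (x1 : hom e1 f1)
    (x1' : hom e1' f1) :
  le (Arrow x1) (Arrow x) -> le (Arrow x1') (Arrow x) -> e1 = e1'.
Proof using biordered leE cancel_l cancel_r.
intros H H'; apply transfer_le in H, H'.
destruct H as (A & B & E), H' as (A' & B' & E').
now apply i_inj, (@transfer_iff _ _ x _ _ _ _ A A' B B' E E').
Qed.

Lemma semigroup_ordered_cancellative : ordered_cancellative le.
Proof using biordered leE X_id X_comp X_inj X_in cancel_l cancel_r
  restriction corestriction all_bimorphisms.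
split.
- exact le_order.
- exact all_bimorphisms.
- intros a b c a' b' c' u v x y; rewrite !leE, !X_comp.
  intros (A & B & E1 & E2) (_ & A' & E3 & E4).
  split; [trivial|split; [trivial|split]].
  + rewrite E3; norm; rewrite X_idr, E1; now norm.
  + rewrite E2, <- (sg_assoc sg) by sg_mem; rewrite X_idl, E4; now norm.
- intros [e1 f1 u] [e f v]; simpl; rewrite leE, <- !le_id; tauto.
- intros [e f u] e1; simpl; rewrite <- le_id; intros H.
  destruct (restriction u H) as (f1 & v & Hv).
  exists (Arrow v); repeat split; trivial.
  intros [e2 f2 w] [Hw Ew]; simpl in Ew; subst e2.
  apply arrow_eq; [trivial|eapply le_unique_cod; eassumption|].
  apply leE in Hv, Hw; destruct Hv as (_ & _ & E & _), Hw as (_ & _ & E' & _).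
  congruence.
- intros [e f u] f1; simpl; rewrite <- le_id; intros H.
  destruct (corestriction u H) as (e1 & v & Hv).
  exists (Arrow v); repeat split; trivial.
  intros [e2 f2 w] [Hw Ew]; simpl in Ew; subst f2.
  apply arrow_eq; [eapply le_unique_dom; eassumption|trivial|].
  apply leE in Hv, Hw; destruct Hv as (_ & _ & _ & E), Hw as (_ & _ & _ & E').
  congruence.
Qed.

(** In the applications z is one of e1 e2 and e2 e1, and w is the product of f1
    and f2 in the same order; then z is R- or L-related to e1, and w to f1.
    The square commutes because m y represents e1 z x and x1 n represents
    x f1 w = e1 x w, which agree by z x = x w. *)
Lemma icc1_square (a b e1 f1 : I) (x : hom a b) (x1 : hom e1 f1) z w :
  le (Arrow x1) (Arrow x) -> core a z -> core b w -> z * X x = X x * w ->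
  z * z = z -> w * w = w ->
  (i e1 * z = z /\ z * i e1 = i e1) \/ (i e1 * z = i e1 /\ z * i e1 = z) ->
  (i f1 * w = w /\ w * i f1 = i f1) \/ (i f1 * w = i f1 /\ w * i f1 = w) ->
  i a * z = z -> z * i a = z ->
  exists (e f : I) (y : hom e f) (m : hom e1 e) (n : hom f1 f),
    i e = z /\ i f = w /\ le (Arrow y) (Arrow x) /\ dist m /\ dist n /\
    m ;; y = x1 ;; n.
Proof using biordered leE X_id X_comp X_inj X_in cancel_l cancel_r
  restriction dist_hom distE.
intros H Hz Hw Ezw Iz Iw Rz Rw La Ra.
destruct (i_surj (core_in Hz) Iz) as [e Ee].
destruct (i_surj (core_in Hw) Iw) as [f Ef].
subst z w.
assert (Ha : omega op i e a) by now split.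
destruct (restriction x Ha) as (f' & y & Hy).
assert (f' = f); [|subst f'].
{ apply i_inj; destruct (transfer_le Hy) as (_ & B & E').
  apply (@transfer_iff a b x (i e) (i e)); trivial. }
assert (De : R_rel op i e1 e \/ L_rel op i e1 e).
{ unfold R_rel, L_rel, omega_r, omega_l; tauto. }
assert (Df : R_rel op i f1 f \/ L_rel op i f1 f).
{ unfold R_rel, L_rel, omega_r, omega_l; tauto. }
destruct (dist_hom De) as [m Em], (dist_hom Df) as [n En].
exists e, f, y, m, n; rewrite !distE.
do 5 (split; [now auto|]); apply X_inj; rewrite !X_comp, Em, En.
apply leE in H, Hy; destruct H as (A & B & E1 & E2), Hy as (_ & _ & E3 & E4).
rewrite E3, E2; norm; use (i_idem e); use (i_idem f1).
destruct (transfer_le (proj2 (leE _ _) (conj A (conj B (conj E1 E2)))))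
  as (_ & _ & E).
rewrite <- E; rewrite <- !(sg_assoc sg) by sg_mem; now rewrite Ezw.
Qed.

Lemma omega_core_mul a e1 e2 : omega op i e1 a -> omega op i e2 a ->
  i a * (i e1 * i e2) = i e1 * i e2 /\ i e1 * i e2 * i a = i e1 * i e2.
Proof using biordered.
intros [_ H1] [H2 _]; split; norm; [now rewrite H1|].
rewrite <- (sg_assoc sg) by sg_mem; now rewrite H2.
Qed.

Lemma icc1_r (a b e1 f1 e2 f2 : I) (x : hom a b) (x1 : hom e1 f1)
    (x2 : hom e2 f2) :
  le (Arrow x1) (Arrow x) -> le (Arrow x2) (Arrow x) ->
  omega_r op i e1 e2 -> omega_r op i f1 f2 ->
  exists (e f : I) (y : hom e f) (m : hom e1 e) (n : hom f1 f),
    i e = i e1 * i e2 /\ i f = i f1 * i f2 /\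
    le (Arrow y) (Arrow x) /\ dist m /\ dist n /\ m ;; y = x1 ;; n.
Proof using biordered leE X_id X_comp X_inj X_in cancel_l cancel_r
  restriction dist_hom distE.
intros H1 H2 He Hf; unfold omega_r in *.
destruct (transfer_le H1) as (A1 & B1 & E1).
destruct (transfer_le H2) as (A2 & B2 & E2).
destruct (omega_core_mul (proj1 (proj1 (leE _ _) H1))
  (proj1 (proj1 (leE _ _) H2))) as [La Ra].
apply icc1_square; trivial; try now apply generated_op.
- now apply transfer_mul; sg_mem.
- norm; use He; now use (i_idem e1).
- norm; use Hf; now use (i_idem f1).
- left; norm; use He; now use (i_idem e1).
- left; norm; use Hf; now use (i_idem f1).
Qed.

Lemma icc1_l (a b e1 f1 e2 f2 : I) (x : hom a b) (x1 : hom e1 f1)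
    (x2 : hom e2 f2) :
  le (Arrow x1) (Arrow x) -> le (Arrow x2) (Arrow x) ->
  omega_l op i e1 e2 -> omega_l op i f1 f2 ->
  exists (e f : I) (y : hom e f) (m : hom e1 e) (n : hom f1 f),
    i e = i e2 * i e1 /\ i f = i f2 * i f1 /\
    le (Arrow y) (Arrow x) /\ dist m /\ dist n /\ m ;; y = x1 ;; n.
Proof using biordered leE X_id X_comp X_inj X_in cancel_l cancel_r
  restriction dist_hom distE.
intros H1 H2 He Hf; unfold omega_l in *.
destruct (transfer_le H1) as (A1 & B1 & E1).
destruct (transfer_le H2) as (A2 & B2 & E2).
destruct (omega_core_mul (proj1 (proj1 (leE _ _) H2))
  (proj1 (proj1 (leE _ _) H1))) as [La Ra].
apply icc1_square; trivial; try now apply generated_op.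
- now apply transfer_mul; sg_mem.
- norm; use He; now use (i_idem e1).
- norm; use Hf; now use (i_idem f1).
- right; norm; use He; now use (i_idem e1).
- right; norm; use Hf; now use (i_idem f1).
Qed.

Lemma dist_restriction (g h e : I) (m : hom g h) :
  dist m -> omega op i e g ->
  exists (f : I) (n : hom e f),
    i f = i h * i e * i h /\ dist n /\ le (Arrow n) (Arrow m).
Proof using biordered leE X_in dist_hom distE.
rewrite distE; intros [[[H1 H2]|[H1 H2]] Em] [H3 H4];
  unfold omega_l, omega_r in *.
-
  (* If g and h are R-related then he = hge = ge = e, whence heh = eh. *)
  assert (He : i h * i e = i e).
  { rewrite <- H4 at 1; norm; now rewrite H1, H4. }
  destruct (i_surj (x := i e * i h)) as [f Ef]; [sg_mem| |].
  { norm; use He; now use (i_idem e). }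
  assert (R : R_rel op i e f \/ L_rel op i e f).
  { left; unfold R_rel, omega_r; rewrite Ef; norm; use He.
    now rewrite !(i_idem e). }
  destruct (dist_hom R) as [n En].
  exists f, n; rewrite distE, leE, En, Em.
  split; [rewrite Ef; now use He|split; [auto|]].
  unfold omega, omega_l, omega_r; rewrite Ef; norm.
  rewrite (i_idem e), H3, He.
  use (i_idem h); repeat split; trivial.
  use H2; use He; trivial.
-
  (* If g and h are L-related then eh = egh = eg = e, whence heh = he. *)
  assert (He : i e * i h = i e).
  { rewrite <- H3 at 1; use H1; trivial. }
  destruct (i_surj (x := i h * i e)) as [f Ef]; [sg_mem| |].
  { norm; use He; now use (i_idem e). }
  assert (R : R_rel op i e f \/ L_rel op i e f).
  { right; unfold L_rel, omega_l; rewrite Ef; norm; use He.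
    now use (i_idem e). }
  destruct (dist_hom R) as [n En].
  exists f, n; rewrite distE, leE, En, Em.
  split; [rewrite Ef; now use He|split; [auto|]].
  unfold omega, omega_l, omega_r; rewrite Ef; norm.
  use He; use (i_idem e); use (i_idem h); use H1.
  now rewrite H3, H4.
Qed.

Lemma semigroup_inductive_cancellative :
  inductive_cancellative le op S i dist.
Proof using All.
split.
- exact semigroup_ordered_cancellative.
- exact biordered.
- exact le_id.
- intros e f m H; now apply distE in H.
- intros e f H; destruct (dist_hom H) as [m Em].
  exists m; split; [now apply distE|].
  intros m' Hm'; apply distE in Hm'; apply X_inj; now rewrite Em.
- intros e; apply distE; rewrite X_id, i_idem; split; trivial.
  left; split; apply i_idem.
- intros e f g m n H Hm Hn; apply distE in Hm, Hn; apply distE.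
  destruct Hm as [_ Em], Hn as [_ En]; rewrite X_comp, Em, En.
  unfold R_rel, L_rel, omega_l, omega_r in *; norm; use (i_idem f).
  destruct H as [[[H1 H2] [H3 H4]]|[[H1 H2] [H3 H4]]].
  + split.
    * left; split; [rewrite <- H1 at 1|rewrite <- H4 at 1]; norm.
      -- rewrite H3; exact H1.
      -- rewrite H2; exact H4.
    * rewrite H2, H4; rewrite <- H4 at 2; norm. now rewrite H2.
  + split.
    * right; split; [rewrite <- H1 at 1|rewrite <- H4 at 1]; norm.
      -- use H3; exact H1.
      -- use H2; exact H4.
    * now rewrite H1.
- exact dist_restriction.
- intros a b e1 f1 e2 f2 x x1 x2 H1 H2 H.
  assert (H' := proj1 (omega_r_transfer H1 H2) H).
  split; [trivial|exact (icc1_r H1 H2 H H')].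
- intros a b e1 f1 e2 f2 x x1 x2 H1 H2 H.
  assert (H' := proj1 (omega_l_transfer H1 H2) H).
  split; [trivial|exact (icc1_l H1 H2 H H')].
- intros a b e1 f1 e2 f2 x x1 x2 H1 H2 H.
  assert (H' := proj2 (omega_r_transfer H1 H2) H).
  split; [trivial|exact (icc1_r H1 H2 H' H)].
- intros a b e1 f1 e2 f2 x x1 x2 H1 H2 H.
  assert (H' := proj2 (omega_l_transfer H1 H2) H).
  split; [trivial|exact (icc1_l H1 H2 H' H)].
- intros e f g h ef fh eg gh Sq Hef Hfh Heg Hgh.
  apply distE in Hef, Hfh, Heg, Hgh.
  destruct Hef as [_ Eef], Hfh as [_ Efh], Heg as [_ Eeg], Hgh as [_ Egh].
  apply X_inj; rewrite !X_comp, Eef, Efh, Eeg, Egh; norm.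
  use (i_idem f); use (i_idem g).
  destruct Sq as [(k & H1 & H2 & [H3 H4] & Eg & Eh)|
    (k & H1 & H2 & [H3 H4] & Ef & Eh)]; unfold omega_l, omega_r in *.
  + rewrite Eg, Eh; norm; use H1; use H2; use (i_idem e); use H4.
    now use (i_idem f).
  + rewrite Ef, Eh; norm; use H2; use (i_idem e); now use H3.
Qed.

End SemigroupCategory.

(** * The transposes of the legs of the cones of idempotents *)

Section Compatibility.
Context {Om : cross_connection} (chi_bij : chi_bijective Om)
  (biordered : regular_biordered_set (@linked_mul Om) (@E_idempotent Om)
    (@linked Om)).
Notation E := (E_set Om).
Notation i := (@E_idempotent Om).
Notation "x * y" := (@linked_mul Om x y).
Notation omega_l := (omega_l (@linked_mul Om) i).
Notation omega_r := (omega_r (@linked_mul Om) i).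
Notation omega := (omega (@linked_mul Om) i).

Let sg := proj1 biordered.
Let i_in := biordered_in biordered.
Let i_idem := biordered_idem biordered.
Let i_ex := biordered_ex biordered.

Lemma linked_closed x y : linked x -> linked y -> linked (x * y).
Proof using biordered. apply (sg_closed sg). Qed.

Hint Resolve i_in linked_closed : sg.
Ltac norm := sg_norm sg.
Ltac use H := sg_use sg H.

Definition compatible (e f : E) : Prop :=
  @transpose Om e f (E_gamma f (Ec e)) = E_delta e (Ed f).

Lemma compatible_mul (e f : E) :
  compatible e f -> i e * i f = @pair_of Om e f (E_gamma f (Ec e)).
Proof. intros H; rewrite E_mul; unfold pair_of; now rewrite H. Qed.

(** Comparing components in eg = ehg gives gamma_g(c_e) = gamma_h(c_e)
    gamma_g(c_h) and the corresponding factorisation of delta_e(d_g). *)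
Lemma compatible_trans (e h g : E) :
  i e * i g = i e * i h * i g -> compatible e h -> compatible h g ->
  compatible e g.
Proof using biordered.
intros H Heh Hhg; unfold compatible.
assert (Eg : E_gamma g (Ec e) = E_gamma h (Ec e) ;; E_gamma g (Ec h)).
{ apply (star_epic_inj (E_gamma_idem e)).
  rewrite <- (cone_mul_star_epic _ (existT _ _ (E_gamma g)))
    by apply E_gamma_epi.
  exact (f_equal fst H). }
assert (Ed : E_delta e (Ed g) = E_delta h (Ed g) ;; E_delta e (Ed h)).
{ apply (star_epic_inj (E_delta_idem g)).
  rewrite <- (cone_mul_star_epic _ (existT _ _ (E_delta e)))
    by apply E_delta_epi.
  rewrite <- (sg_assoc sg) in H by sg_mem.
  exact (f_equal snd H). }
now rewrite Eg, Ed, (transpose_mul (f := h)), Heh, Hhg.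
Qed.

(** Here gamma_f(c_e) is the inclusion of c_e in c_f, and Delta maps it to an
    inclusion. *)
Lemma compatible_omega_l (e f : E) : omega_l e f -> compatible e f.
Proof.
intros H; apply omega_l_sub in H; destruct H as [j Hj].
unfold compatible; rewrite (idempotent_leg (E_gamma_idem f) Hj).
exact (transposeE (transpose_inclusion (Delta_local Om) (E_M' e) (E_M' f) Hj)).
Qed.

(** Let d be the common second coordinate.  The cone gamma_f is both
    gamma_f * 1 and gamma_e * h with h = gamma_f(c_e), so that chi(c_f,d) maps it
    to delta_f and to delta_f * (h‡)°; hence h‡ is an identity, as is
    delta_e(d). *)
Lemma compatible_R (e f : E) : omega_r e f -> omega_r f e -> compatible e f.
Proof using chi_bij.
rewrite !omega_r_sub; intros H [j Hj]; unfold compatible.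
rewrite (idempotent_leg (E_delta_idem e) Hj).
destruct H as [j' Hj'].
assert (Eq := inclusion_antisym Hj Hj'); injection Eq; intros _ Ed_eq; clear Eq.
revert j Hj j' Hj'; destruct e as [[c d] pe], f as [[c1 d1] pf]; simpl in *.
unfold Ed in Ed_eq |- *; simpl in *; subst d1; intros j Hj j' Hj'.
rewrite (inclusion_thin Hj (inclusion_id _)); clear j Hj.
set (e := exist _ (c, d) pe : E); set (f := exist _ (c1, d) pf : E).
set (h := E_gamma f (Ec e)); set (t := @transpose Om e f h).
destruct (chi_bij c1 d) as (chi_in & chi_fun & _).
assert (chi1 : @chi Om c1 d (star_epic (E_gamma e) h) (star_epic (E_delta f) t)).
{ exists c, d, h, t; split; [exact pe|split; [exact (E_M' f)|]].
  split; [exact (transposeP h)|now split]. }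
assert (chi2 : @chi Om c1 d (star_epic (E_gamma f) (idm c1))
  (star_epic (E_delta f) (idm d))).
{ exists c1, d, (idm c1), (idm d); split; [exact pf|split; [exact (E_M' f)|]].
  split; [exact (transpose_id (F := Delta Om) (k := c1) (c := d))|now split]. }
assert (Eh : star_epic (E_gamma e) h = star_epic (E_gamma f) (idm c1)).
{ apply star_epic_eq; try apply E_gamma_epi.
  intros a; rewrite comp_idr; symmetry; apply (E_gamma_sub (e := f) (f := e)).
  exists (idm d); apply inclusion_id. }
rewrite Eh in chi1.
destruct (chi_fun _ (proj1 (chi_in _ _ chi2))) as (y & _ & Hy).
apply (star_epic_inj (E_delta_idem f)).
exact (eq_trans (eq_sym (Hy _ chi1)) (Hy _ chi2)).
Qed.

(** For f below g the retraction gamma_f(c_g), followed by the inclusion, is an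
    idempotent endomorphism of c_g, so its linked pair is an idempotent f'.  The
    first components of f' and f agree, and as Gamma is injective on the ideal
    of d_g this forces f' = f; comparing second components gives the
    transpose. *)
Lemma compatible_omega (f g : E) : omega f g -> compatible g f.
Proof using biordered.
intros [Hl Hr]; unfold compatible.
assert (Ej := compatible_omega_l Hl); unfold compatible in Ej.
assert (Hl' := proj1 (omega_l_sub _ _) Hl).
assert (Hr' := proj1 (omega_r_sub _ _) Hr).
assert (Gs := E_gamma_sub Hr'); assert (Ds := E_delta_sub Hl').
destruct Hl' as [j Hj], Hr' as [jd Hjd].
assert (Gj := idempotent_leg (E_gamma_idem g) Hj).
assert (Dj := idempotent_leg (E_delta_idem g) Hjd).
rewrite Gj in Ej; rewrite Dj.
set (k := E_gamma f (Ec g)) in *; set (l := E_delta f (Ed g)) in *.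
assert (jk : j ;; k = idm (Ec f)).
{ rewrite <- (proj2 (E_gamma_idem f)), Gs, Gj; reflexivity. }
assert (jl : jd ;; l = idm (Ed f)).
{ rewrite <- (proj2 (E_delta_idem f)), Ds, Dj; reflexivity. }
set (t := @transpose Om g f k).
set (p := @pair_of Om g g (k ;; j)).
destruct (i_ex (x := p)) as [f' Ef'].
{ apply pair_of_linked. }
{ unfold p; rewrite pair_of_mul, comp_assoc, <- (comp_assoc k), jk, comp_idr.
  reflexivity. }
assert (f' = f); [|subst f'].
{ assert (Eg : existT (@cone _) (Ec f') (E_gamma f') =
    existT (@cone _) (Ec f) (E_gamma f)).
  { transitivity (fst p); [now rewrite <- Ef'|].
    rewrite <- star_epic_id, <- (star_epic_inclusion _ _ Hj), comp_idl.
    apply star_epic_eq; try apply E_gamma_epi.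
    intros a; now rewrite Gs, comp_assoc. }
  assert (Hf' : subobject (Ed f') (Ed g)).
  { apply omega_r_sub; unfold Defs.omega_r; rewrite Ef'; apply pair_of_idl. }
  destruct (apex_coneP (E_M f)) as [idem Ef].
  destruct (apex_coneP (E_M f')) as [idem' Ef2].
  assert (Edd : Ed f' = Ed f).
  { apply (ideal_inj (Gamma_local Om) (d := Ed g)); [trivial|now exists jd|].
    rewrite <- Ef, <- Ef2; now apply H_functor_cone_eq. }
  apply sig_eq; injection Eg; intros _ Ecc.
  now apply injective_projections. }
assert (lt : l ;; t = l ;; jd).
{ apply (star_epic_inj (E_delta_idem g)).
  transitivity (snd p).
  - unfold p; simpl; now rewrite (transpose_mul (f := f)), Ej.
  - rewrite <- Ef'; transitivity (star_epic (E_delta f) (idm (Ed f) ;; jd)).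
    + now rewrite (star_epic_inclusion _ _ Hjd), star_epic_id.
    + rewrite comp_idl; apply star_epic_eq; try apply E_delta_epi.
      intros a; now rewrite Ds, comp_assoc. }
rewrite <- (comp_idl jd), <- jl, <- comp_assoc, <- lt, comp_assoc, jl.
symmetry; apply comp_idl.
Qed.

(** The idempotent f = hg is R-related to h and lies below g, and hg = hfg. *)
Lemma compatible_omega_r (h g : E) : omega_r h g -> compatible h g.
Proof using biordered chi_bij.
intros H; unfold Defs.omega_r in H.
destruct (i_ex (x := i h * i g)) as [f Ef]; [sg_mem| |].
{ norm; use H; now use (i_idem h). }
apply (compatible_trans (h := f)).
- rewrite Ef; norm; use (i_idem h); now use (i_idem g).
- apply compatible_R; unfold Defs.omega_r; rewrite Ef; norm; [use H|];
    now use (i_idem h).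
- apply compatible_omega_l; unfold Defs.omega_l; rewrite Ef.
  now use (i_idem g).
Qed.

(** The idempotent f = eh lies below e and is L-related to h, and eh = efh. *)
Lemma compatible_omega_l_inv (h e : E) : omega_l h e -> compatible e h.
Proof using biordered.
intros H; unfold Defs.omega_l in H.
destruct (i_ex (x := i e * i h)) as [f Ef]; [sg_mem| |].
{ norm; use H; now use (i_idem h). }
apply (compatible_trans (h := f)).
- rewrite Ef; norm; use (i_idem e); now use (i_idem h).
- apply compatible_omega; split; unfold Defs.omega_l, Defs.omega_r;
    rewrite Ef; norm; [now use H|now use (i_idem e)].
- apply compatible_omega_l; unfold Defs.omega_l; rewrite Ef.
  now use (i_idem h).
Qed.

Lemma generated_linked x :
  generated (@linked_mul Om) (idempotent_in (@linked_mul Om) (@linked Om)) x ->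
  linked x.
Proof using biordered.
induction 1 as [x [H _]|]; [trivial|now apply linked_closed].
Qed.

(** An inverse z of eg yields the sandwich element h = gze: it is an idempotent
    with h omega^l e, h omega^r g and ehg = eg, so that the two one-sided cases
    compose. *)
Lemma all_compatible (e g : E) : compatible e g.
Proof using biordered chi_bij.
pose proof (proj2 (proj2 (proj2 biordered))) as reg.
assert (gen : forall e, generated (@linked_mul Om)
  (idempotent_in (@linked_mul Om) (@linked Om)) (i e)).
{ intros h; apply generated_in; split; sg_mem. }
destruct (reg (i e * i g)) as (y & Hy & Ey); [now apply generated_op|].
apply generated_linked in Hy.
assert (inv : exists z, linked z /\ i e * i g * z * (i e * i g) = i e * i g /\
  z * (i e * i g) * z = z).
{ assert (Ha : linked (i e * i g)) by sg_mem.
  revert Ey Ha; generalize (i e * i g); intros a Ey Ha.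
  exists (y * a * y); split; [sg_mem|norm; split].
  - now rewrite !Ey.
  - replace (y * a * y * a * y * a * y) with (y * (a * y * a * y * a) * y)
      by now norm.
    rewrite !Ey; now norm. }
destruct inv as (z & Hz & Ez & Ez'); clear y Hy Ey.
destruct (i_ex (x := i g * z * i e)) as [h Eh]; [sg_mem| |].
{ transitivity (i g * (z * (i e * i g) * z) * i e); [now norm|].
  now rewrite Ez'. }
apply (compatible_trans (h := h)).
- rewrite <- Ez at 1; rewrite Eh; now norm.
- apply compatible_omega_l_inv; unfold Defs.omega_l; rewrite Eh.
  now use (i_idem e).
- apply compatible_omega_r; unfold Defs.omega_r; rewrite Eh; norm.
  now use (i_idem g).
Qed.

Lemma E_mul_pair (e f : E) : i e * i f = @pair_of Om e f (E_gamma f (Ec e)).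
Proof using biordered chi_bij. apply compatible_mul, all_compatible. Qed.

(** * Connecting isomorphisms *)

Lemma omega_retract (e e1 : E) :
  omega e1 e ->
  inclusion (E_gamma e (Ec e1)) /\
  E_gamma e (Ec e1) ;; E_gamma e1 (Ec e) = idm (Ec e1) /\
  i e1 = @pair_of Om e e (E_gamma e1 (Ec e) ;; E_gamma e (Ec e1)).
Proof using biordered chi_bij.
intros [Hl Hr]; split; [|split].
- destruct (proj1 (omega_l_sub _ _) Hl) as [j Hj].
  now rewrite (idempotent_leg (E_gamma_idem e) Hj).
- rewrite <- E_gamma_sub by now apply omega_r_sub.
  apply E_gamma_idem.
- rewrite <- (pair_of_mul (f := e1)), <- !E_mul_pair; norm.
  unfold Defs.omega_l, Defs.omega_r in *; use (i_idem e1).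
  now rewrite Hr, Hl.
Qed.

Lemma retract_idempotent (e : E) (c1 : xcC Om) (j : hom c1 (Ec e))
    (p : hom (Ec e) c1) :
  inclusion j -> j ;; p = idm c1 ->
  exists e1 : E,
    omega e1 e /\ i e1 = @pair_of Om e e (p ;; j) /\ Ec e1 = c1.
Proof using biordered.
intros Hj Hp.
destruct (i_ex (x := @pair_of Om e e (p ;; j))) as [e1 E1].
- apply pair_of_linked.
- now rewrite pair_of_mul, comp_assoc, <- (comp_assoc p), Hp, comp_idr.
- exists e1; split; [split|split; [trivial|]].
  + unfold Defs.omega_l; rewrite E1; apply pair_of_idr.
  + unfold Defs.omega_r; rewrite E1; apply pair_of_idl.
  + assert (epi_p : epi p) by (apply retraction_epi; now exists j).
    transitivity (projT1 (fst (i e1))); [reflexivity|].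
    rewrite E1; unfold pair_of; simpl fst.
    now rewrite (star_epic_inclusion _ _ Hj), (star_epic_epi _ epi_p).
Qed.

(** A morphism between idempotents below e and f and a morphism from e to f can
    be the same element of S. *)
Lemma pair_of_below (e f e1 f1 : E) (v : hom (Ec e1) (Ec f1)) :
  omega e1 e -> omega f1 f ->
  pair_of v = @pair_of Om e f (E_gamma e1 (Ec e) ;; v ;; E_gamma f (Ec f1)).
Proof using biordered chi_bij.
intros [_ He] [Hf _]; unfold Defs.omega_l, Defs.omega_r in *.
rewrite <- (pair_of_mul (f := f1)), <- (pair_of_mul (f := e1)).
now rewrite <- !E_mul_pair, He, Hf, pair_of_idl, pair_of_idr.
Qed.

Lemma cut_of_square (e f e1 f1 : E) (u : hom (Ec e) (Ec f))
    (v : hom (Ec e1) (Ec f1)) (j : hom (Ec e1) (Ec e)) (k : hom (Ec f1) (Ec f)) :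
  bimorphism v -> inclusion j -> inclusion k -> v ;; k = j ;; u -> is_cut u v.
Proof.
intros [_ Hv] Hj Hk E; exists j; split; trivial.
now apply epimorphic_component_unique with k.
Qed.

Lemma pair_restriction (e f e1 : E) (u : hom (Ec e) (Ec f)) :
  bimorphism u -> omega e1 e ->
  exists (f1 : E) (v : hom (Ec e1) (Ec f1)),
    omega f1 f /\ bimorphism v /\ is_cut u v /\
    pair_of v = i e1 * pair_of u /\ pair_of v = pair_of u * i f1.
Proof using biordered chi_bij.
intros bim He; destruct (omega_retract He) as (Hj & Hp & Ee).
destruct (bimorphism_image bim Hj Hp)
  as (d1 & k & q & v & Hk & Hq & Hv & Ev & Ev').
destruct (retract_idempotent Hk Hq) as (f1 & Hf & Ef & <-).
exists f1, v; split; [trivial|split; [trivial|split]].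
- exact (cut_of_square Hv Hj Hk Ev).
- rewrite (pair_of_below v He Hf), (idempotent_leg (E_gamma_idem f) Hk).
  rewrite Ee, Ef, !pair_of_mul; split; f_equal.
  + now rewrite <- comp_assoc, Ev, comp_assoc.
  + now rewrite Ev', comp_assoc.
Qed.

Lemma pair_corestriction (e f f1 : E) (u : hom (Ec e) (Ec f)) :
  bimorphism u -> omega f1 f ->
  exists (e1 : E) (v : hom (Ec e1) (Ec f1)),
    omega e1 e /\ bimorphism v /\ is_cut u v /\
    pair_of v = i e1 * pair_of u /\ pair_of v = pair_of u * i f1.
Proof using biordered chi_bij.
intros bim Hf; destruct (omega_retract Hf) as (Hk & Hq & Ef).
destruct (bimorphism_preimage bim Hk Hq)
  as (c1 & j & p & v & Hj & Hp & Hv & Ev & Ev').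
destruct (retract_idempotent Hj Hp) as (e1 & He & Ee & <-).
destruct (omega_retract He) as (Hj' & Hp' & Ee').
assert (Ep : p = E_gamma e1 (Ec e)).
{ assert (E0 : p ;; j = E_gamma e1 (Ec e) ;; E_gamma e (Ec e1)).
  { apply (@pair_of_inj Om e e); congruence. }
  rewrite (idempotent_leg (E_gamma_idem e) Hj) in E0.
  exact (inclusion_mono Hj E0). }
exists e1, v; split; [trivial|split; [trivial|split]].
- exact (cut_of_square Hv Hj Hk Ev).
- rewrite (pair_of_below v He Hf), <- Ep, Ee, Ef, !pair_of_mul; split; f_equal.
  + now rewrite <- comp_assoc, Ev, comp_assoc.
  + now rewrite Ev', comp_assoc.
Qed.

(** Elements of the subsemigroup generated by the idempotents below e come from
    endomorphisms of c_e; bimorphisms can be cancelled against these. *)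
Lemma core_pair (e : E) y :
  E_core e y -> exists a : hom (Ec e) (Ec e), y = pair_of a.
Proof using biordered chi_bij.
unfold E_core, core_semigroup.
induction 1 as [y [[Hy Iy] [H1 H2]]|x y _ [a Ha] _ [b Hb]].
- destruct (i_ex Hy Iy) as [e1 <-].
  destruct (omega_retract (e := e) (e1 := e1)) as (_ & _ & Ey);
    [now split|eauto].
- exists (a ;; b); rewrite Ha, Hb; apply pair_of_mul.
Qed.

Lemma core_linked (e : E) y : E_core e y -> linked y.
Proof using biordered chi_bij.
intros H; destruct (core_pair H) as [a ->]; apply pair_of_linked.
Qed.

Lemma core_omega_in (e e1 : E) : omega e1 e -> E_core e (i e1).
Proof using biordered.
intros [H1 H2]; apply generated_in; split; [split|]; auto.
Qed.

Hint Resolve core_linked pair_of_linked : sg.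

Section Connecting.
Context (e f : E) (u : hom (Ec e) (Ec f)) (bim : bimorphism u).

Lemma pair_cancel_l s t :
  E_core f s -> E_core f t -> pair_of u * s = pair_of u * t -> s = t.
Proof using biordered chi_bij bim.
intros Hs Ht; destruct (core_pair Hs) as [a ->], (core_pair Ht) as [b ->].
rewrite !pair_of_mul; intros H; f_equal; now apply bim, pair_of_inj.
Qed.

Lemma pair_cancel_r s t :
  E_core e s -> E_core e t -> s * pair_of u = t * pair_of u -> s = t.
Proof using biordered chi_bij bim.
intros Hs Ht; destruct (core_pair Hs) as [a ->], (core_pair Ht) as [b ->].
rewrite !pair_of_mul; intros H; f_equal; now apply bim, pair_of_inj.
Qed.

Lemma core_transfer s :
  E_core e s -> exists t, E_core f t /\ s * pair_of u = pair_of u * t.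
Proof using biordered chi_bij bim.
intros H; induction H
  as [s [[Hs Is] [H1 H2]]|s s' H1 (t & Ht & E1) H2 (t' & Ht' & E2)].
- destruct (i_ex Hs Is) as [e1 <-].
  destruct (pair_restriction bim (conj H1 H2))
    as (f1 & v & Hf & _ & _ & E1 & E2).
  exists (i f1); split; [now apply core_omega_in|congruence].
- exists (t * t'); split; [now apply generated_op|].
  rewrite <- (sg_assoc sg) by sg_mem; rewrite E2; norm; now rewrite E1.
Qed.

Lemma core_transfer_inv t :
  E_core f t -> exists s, E_core e s /\ s * pair_of u = pair_of u * t.
Proof using biordered chi_bij bim.
intros H; induction H
  as [t [[Ht It] [H1 H2]]|t t' H1 (s & Hs & E1) H2 (s' & Hs' & E2)].
- destruct (i_ex Ht It) as [f1 <-].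
  destruct (pair_corestriction bim (conj H1 H2))
    as (e1 & v & He & _ & _ & E1 & E2).
  exists (i e1); split; [now apply core_omega_in|congruence].
- exists (s * s'); split; [now apply generated_op|].
  rewrite <- (sg_assoc sg) by sg_mem; rewrite E2; norm; now rewrite E1.
Qed.

(** The element defining the connecting isomorphism of u is X(u), because both
    u and its transpose are epimorphisms. *)
Lemma star_pair_of (ut : hom (Ed f) (Ed e)) :
  is_transpose u ut ->
  (existT _ (Ec f) (star (E_gamma e) u), existT _ (Ed e) (star (E_delta f) ut))
  = pair_of u.
Proof using bim.
intros H; change (transpose_of (Delta Om) u ut) in H.
assert (epi_ut : epi ut).
{ apply (transpose_epi (Delta_local Om) (E_M' e) (E_M' f) H); [|apply bim].
  intros z; destruct (M_set_inhabited (Gamma Om) z) as [k Hk].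
  exists k; now apply Gamma_Delta. }
unfold pair_of; rewrite (transposeE H).
now rewrite (star_epic_epi _ epi_ut), (star_epic_epi _ (proj2 bim)).
Qed.

Lemma connecting_isomorphism_exists : exists ups, connecting_isomorphism u ups.
Proof using biordered chi_bij bim.
set (ups := fun s => epsilon (inhabits s)
  (fun t => E_core f t /\ s * pair_of u = pair_of u * t)).
assert (upsP : forall s, E_core e s ->
  E_core f (ups s) /\ s * pair_of u = pair_of u * ups s).
{ intros s Hs; apply (epsilon_spec (inhabits s)), (core_transfer Hs). }
exists ups, (transpose u); split; [exact (transposeP u)|].
intros x; unfold x; rewrite (star_pair_of (transposeP u)).
split; [split; [|split]|]; intros s.
- apply upsP.
- intros Hs; destruct (core_transfer_inv Hs) as (t & Ht & Et).
  exists t; destruct (upsP t Ht) as [H1 H2]; split; [split; trivial|].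
  + apply pair_cancel_l; congruence.
  + intros t' [Ht' <-]; apply pair_cancel_r; trivial.
    now rewrite Et, <- (proj2 (upsP t' Ht')).
- intros t Hs Ht; destruct (upsP s Hs) as [H1 H2], (upsP t Ht) as [H3 H4].
  assert (Hst : E_core e (s * t)) by now apply generated_op.
  destruct (upsP _ Hst) as [H5 H6].
  apply pair_cancel_l; [trivial|now apply generated_op|].
  rewrite <- H6; norm; rewrite <- H2; rewrite <- !(sg_assoc sg) by sg_mem.
  now rewrite H4.
- apply upsP.
Qed.

(** By cancellation, f1 is the only element t below f with e1 X(u) = X(u) t, so
    it is the image of e1 under every connecting isomorphism. *)
Lemma connectsE (e1 f1 : E) :
  omega e1 e ->
  connects u e1 f1 <-> omega f1 f /\ i e1 * pair_of u = pair_of u * i f1.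
Proof using biordered chi_bij bim.
intros He; assert (Hc := core_omega_in He); split.
- intros (ups & (ut & Hut & H) & E1); simpl in H.
  rewrite (star_pair_of Hut) in H; destruct H as [[H _] H'].
  apply H in Hc as Hf; rewrite E1 in Hf.
  destruct (core_pair Hf) as [a Ea].
  split; [split|].
  + unfold Defs.omega_l; rewrite Ea; apply pair_of_idr.
  + unfold Defs.omega_r; rewrite Ea; apply pair_of_idl.
  + rewrite <- E1; now apply H'.
- intros [Hf E1]; destruct connecting_isomorphism_exists as [ups Hups].
  exists ups; split; trivial; destruct Hups as (ut & Hut & H); simpl in H.
  rewrite (star_pair_of Hut) in H; destruct H as [[H _] H'].
  apply pair_cancel_l; [now apply H|now apply core_omega_in|].
  rewrite <- E1; symmetry; now apply H'.
Qed.

End Connecting.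

(** * The category of idempotents and bimorphisms *)

Notation I := (I_category Om).

Let X (e f : I) (u : hom e f) := @pair_of Om e f (proj1_sig u).

(** Given the condition on connecting isomorphisms, the restriction equation
    u = (jv)° is the commutativity of a square with the inclusions of c_e1 in
    c_e and of c_f1 in c_f, that is, X(u) = e1 X(v). *)
Lemma I_leE (e1 f1 e f : I) (u : hom e1 f1) (v : hom e f) :
  I_le (Arrow u) (Arrow v) <->
  omega e1 e /\ omega f1 f /\ X u = i e1 * X v /\ X u = X v * i f1.
Proof using biordered chi_bij.
unfold I_le; simpl; rewrite <- omega_sub; unfold X.
destruct u as [u Hu], v as [v Hv]; simpl in *; split.
- intros (He & (j & Hj & Ej) & Hc).
  apply (connectsE Hv _ He) in Hc; destruct Hc as [Hf Hc].
  split; [trivial|split; [trivial|rewrite <- Hc]].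
  enough (pair_of u = i e1 * pair_of v) by now split.
  destruct (omega_retract He) as (_ & _ & Ee).
  destruct (epimorphic_component_spec Ej) as (_ & k & Hk & Ek).
  rewrite (pair_of_below u He Hf), Ee, pair_of_mul; f_equal.
  rewrite (idempotent_leg (E_gamma_idem f) Hk).
  rewrite (idempotent_leg (E_gamma_idem e) Hj).
  now rewrite <- !comp_assoc, Ek.
- intros (He & Hf & E1 & E2).
  split; [trivial|split; [|apply connectsE; trivial; split; congruence]].
  destruct (omega_retract He) as (Hj & Hp & Ee).
  destruct (omega_retract Hf) as (Hk & _ & _).
  apply (cut_of_square Hu Hj Hk).
  rewrite (pair_of_below u He Hf), Ee, pair_of_mul in E1.
  apply pair_of_inj in E1; apply (f_equal (comp (E_gamma e (Ec e1)))) in E1.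
  now rewrite !comp_assoc, Hp, !comp_idl in E1.
Qed.

Lemma I_restriction (e f e1 : I) (u : hom e f) :
  omega e1 e -> exists (f1 : I) (v : hom e1 f1),
    is_cut (proj1_sig u) (proj1_sig v) /\ I_le (Arrow v) (Arrow u).
Proof using biordered chi_bij.
intros He; destruct u as [u Hu].
destruct (pair_restriction Hu He) as (f1 & v & Hf & Hv & Hc & E1 & E2).
exists f1, (exist _ v Hv); split; trivial; now apply I_leE.
Qed.

Lemma I_corestriction (e f f1 : I) (u : hom e f) :
  omega f1 f -> exists (e1 : I) (v : hom e1 f1),
    connects (proj1_sig u) e1 f1 /\
    is_cut (proj1_sig u) (proj1_sig v) /\ I_le (Arrow v) (Arrow u).
Proof using biordered chi_bij.
intros Hf; destruct u as [u Hu].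
destruct (pair_corestriction Hu Hf) as (e1 & v & He & Hv & Hc & E1 & E2).
exists e1, (exist _ v Hv); split; [|split; [trivial|now apply I_leE]].
apply connectsE; trivial; split; simpl; congruence.
Qed.

Lemma I_bimorphism (e f : I) (u : hom e f) : bimorphism u.
Proof.
destruct u as [u Hu]; split; intros z g h E; apply sig_eq;
  apply (f_equal (@proj1_sig _ _)) in E; simpl in E; now apply Hu in E.
Qed.

Notation R_rel := (R_rel (@linked_mul Om) i).
Notation L_rel := (L_rel (@linked_mul Om) i).

Lemma I_distinguishedE (e f : I) (m : hom e f) :
  I_distinguished m <-> (R_rel e f \/ L_rel e f) /\ X m = i e * i f.
Proof using biordered chi_bij.
unfold I_distinguished, X; rewrite E_mul_pair; split; intros [H E];
  split; trivial; [now rewrite E|now apply pair_of_inj].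
Qed.

(** If e and f are R- or L-related then (ef)(fe) = e and (fe)(ef) = f, so that
    gamma_f(c_e) is an isomorphism. *)
Lemma I_distinguished_exists (e f : I) :
  R_rel e f \/ L_rel e f -> exists m : hom e f, X m = i e * i f.
Proof using biordered chi_bij.
intros H.
assert (inv : forall e f : E, i e * i f * (i f * i e) = i e ->
  E_gamma f (Ec e) ;; E_gamma e (Ec f) = idm (Ec e)).
{ intros g h E; apply (@pair_of_inj Om g g).
  now rewrite pair_of_id, <- (pair_of_mul (f := h)), <- !E_mul_pair. }
assert (bim : bimorphism (E_gamma f (Ec e))).
{ apply iso_bimorphism; exists (E_gamma e (Ec f)); split; apply inv;
    unfold Defs.R_rel, Defs.L_rel, Defs.omega_r, Defs.omega_l in H; norm;
    destruct H as [[H1 H2]|[H1 H2]].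
  - use (i_idem f); now rewrite H2.
  - use (i_idem f); rewrite H1; apply i_idem.
  - use (i_idem e); now rewrite H1.
  - use (i_idem e); rewrite H2; apply i_idem. }
exists (exist _ (E_gamma f (Ec e)) bim); unfold X; simpl.
symmetry; apply E_mul_pair.
Qed.

End Compatibility.

Theorem theorem7p2 (Om : cross_connection)
  (chi_bij : chi_bijective Om)
  (E_biordered :
     regular_biordered_set (@linked_mul Om) (@E_idempotent Om) (@linked Om)) :
  @inductive_cancellative (I_category Om) (@I_le Om)
    (cones (xcC Om) * cones (xcD Om)) (@linked_mul Om) (@linked Om)
    (@E_idempotent Om) (@I_distinguished Om) /\
  I_restrictions Om /\ I_corestrictions Om.
Proof.
split; [|split].
- apply (semigroup_inductive_cancellative
    (X := fun (e f : I_category Om) u => @pair_of Om e f (proj1_sig u))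
    E_biordered).
  + exact (@I_bimorphism Om).
  + intros e f u; apply pair_of_linked.
  + intros e; apply pair_of_id.
  + intros e f g u v; symmetry; apply pair_of_mul.
  + intros e f u v H; apply sig_eq; exact (pair_of_inj H).
  + intros e f u; exact (pair_cancel_l chi_bij E_biordered (proj2_sig u)).
  + intros e f u; exact (pair_cancel_r chi_bij E_biordered (proj2_sig u)).
  + exact (I_leE chi_bij E_biordered).
  + intros e f e1 u H.
    destruct (I_restriction chi_bij E_biordered u H) as (f1 & v & _ & Hv).
    now exists f1, v.
  + intros e f f1 u H.
    destruct (I_corestriction chi_bij E_biordered u H) as (e1 & v & _ & _ & Hv).
    now exists e1, v.
  + exact (I_distinguishedE chi_bij E_biordered).
  + exact (I_distinguished_exists chi_bij E_biordered).
- intros e f e1 u H; apply (I_restriction chi_bij E_biordered), omega_sub, H.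
- intros e f f1 u H; apply (I_corestriction chi_bij E_biordered), omega_sub, H.
Qed.
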